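(* Let $L$ be a finite flag simplicial complex and let $D(L)$ be the Davis complex of the right-angled Coxeter group $W_L$. Then $D(L)$ is the unique CAT(0) $L$-cube-complex up to isomorphism of cube complexes (i.e. every CAT(0) $L$-cube-complex is isomorphic to $D(L)$) if and only if $L$ is superstar-transitive.
   Context: A CAT(0) cube complex is a 1-connected (connected and simply connected) cube complex all of whose vertex links are flag simplicial complexes. For a vertex $x$ of a cube complex $X$, the link $\mathrm{Lk}(x,X)$ is the simplicial complex whose vertices are the edges incident to $x$ and whose simplices are the collections of edges at $x$ spanning cubes. An $L$-cube-complex is a cube complex all of whose vertex links are isomorphic to $L$. For a simplex $\sigma$ of $L$, the open star $\mathrm{st}_L(\sigma)$ is the union of all open simplices of $L$ whose closure intersects the (closed) simplex $\sigma$. An isomorphism between two open stars is a bijection between their sets of open simplices that preserves dimension and, in both directions, the face relation. $L$ is superstar-transitive if for any two (not necessarily distinct, nonempty) simplices $\sigma,\sigma'$ of $L$ and any isomorphism $\phi:\mathrm{st}_L(\sigma)\to\mathrm{st}_L(\sigma')$ sending $\sigma$ to $\sigma'$, there exists an automorphism $\Phi:L\to L$ with $\Phi|_{\mathrm{st}_L(\sigma)}=\phi$. The right-angled Coxeter group is $W_L=\langle \xi\in L^{(0)}\mid \xi^2=1 \text{ for all }\xi\in L^{(0)},\ [\xi,\zeta]=1 \text{ whenever } \xi,\zeta \text{ are adjacent in } L\rangle$. The Davis complex $D(L)$ is the cube complex obtained from the Cayley graph of $W_L$ with respect to $L^{(0)}$ (with bigons coming from $\xi^2$ collapsed to single edges)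 by adding a cube whenever the 1-skeleton of a cube appears. It is a CAT(0) $L$-cube-complex. *)

(* Defs.v *)
From HB Require Import structures.
From Stdlib Require Import Relation_Operators.
From mathcomp Require Import all_boot.
From mathcomp Require Import boolp classical_sets functions cardinality.

Set Implicit Arguments.
Unset Strict Implicit.
Unset Printing Implicit Defensive.

Local Open Scope classical_set_scope.
Local Open Scope card_scope.
Local Open Scope quotient_scope.

Record simplicialComplex := SimplicialComplex {
  scvert :> Type;
  simplex : set (set scvert);
  simplex_finite : forall s, simplex s -> finite_set s;
  simplex_nonempty : forall s, simplex s -> s !=set0;
  simplex_set1 : forall v, simplex [set v];
  simplex_sub : forall s t, simplex s -> t `<=` s -> t !=set0 -> simplex t }.

Arguments simplex : clear implicits.

Definition sc_finite (L : simplicialComplex) := finite_set [set: L].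

Definition adjacent (L : simplicialComplex) (x y : L) :=
  x <> y /\ simplex L [set x; y].

Definition flag (L : simplicialComplex) := forall s : set L,
  finite_set s -> s !=set0 ->
  (forall x y, s x -> s y -> x <> y -> adjacent x y) -> simplex L s.

Definition is_sc_iso (K L : simplicialComplex) (f : K -> L) :=
  bijective f /\ forall s, simplex K s <-> simplex L (f @` s).

Definition sc_isomorphic (K L : simplicialComplex) :=
  exists f : K -> L, is_sc_iso f.

(* An open simplex is represented by its vertex set.  The closures of two open
   simplices meet iff they have a common vertex. *)
Definition open_star (L : simplicialComplex) (s : set L) : set (set L) :=
  [set t | simplex L t /\ t `&` s !=set0].

Definition is_star_iso (L : simplicialComplex) (s s' : set L)
    (phi : set L -> set L) :=
  [/\ set_bij (open_star s) (open_star s') phi,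
      forall t, open_star s t -> phi t #= t
    & forall t u, open_star s t -> open_star s u ->
        (t `<=` u <-> phi t `<=` phi u)].

Definition superstar_transitive (L : simplicialComplex) :=
  forall (s s' : set L) (phi : set L -> set L),
    simplex L s -> simplex L s' -> is_star_iso s s' phi -> phi s = s' ->
    exists2 Phi : L -> L, is_sc_iso Phi &
      forall t, open_star s t -> Phi @` t = phi t.

Definition cube n := {ffun 'I_n -> bool}.

Definition hdist n (u v : cube n) := #|[set i | u i != v i]%SET|.

Definition isometric m n (f : {ffun cube m -> cube n}) :=
  [forall u, forall v, hdist (f u) (f v) == hdist u v].

(* Recorded by its values on vertices, an isometry of [0,1]^m onto a face of
   [0,1]^n is the same thing as a map {0,1}^m -> {0,1}^n preserving the Hamming
   distance. *)
Record cubeMap m n := CubeMap {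
  cubemap_fun :> {ffun cube m -> cube n};
  cubemap_isometric : isometric cubemap_fun }.

HB.instance Definition _ m n := [isSub for @cubemap_fun m n].

Lemma cubeMap_hdist m n (f : cubeMap m n) u v : hdist (f u) (f v) = hdist u v.
Proof. by have /forallP/(_ u)/forallP/(_ v)/eqP := cubemap_isometric f. Qed.

Lemma id_isometric n : isometric [ffun u : cube n => u].
Proof. by apply/forallP => u; apply/forallP => v; rewrite !ffunE. Qed.

Definition idmap n := CubeMap (id_isometric n).

Lemma comp_isometric l m n (f : cubeMap m n) (g : cubeMap l m) :
  isometric [ffun u => f (g u)].
Proof.
by apply/forallP => u; apply/forallP => v; rewrite !ffunE !cubeMap_hdist.
Qed.

Definition compmap l m n (f : cubeMap m n) (g : cubeMap l m) : cubeMap l n :=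
  CubeMap (comp_isometric f g).

(* The face through the vertex v spanned by the directions h 0, ..., h (m-1),
   parametrised so that 0 goes to v.  Every cubeMap is of this form. *)
Definition face_fun m n (v : cube n) (h : 'I_m -> 'I_n) :
    {ffun cube m -> cube n} :=
  [ffun u : cube m =>
    [ffun j => v j (+) [exists i, (h i == j) && u i]] : cube n].

Lemma face_isometric m n (v : cube n) (h : 'I_m -> 'I_n) :
  injective h -> isometric (face_fun v h).
Proof.
move=> hI; have memh (u : cube m) i : [exists k, (h k == h i) && u k] = u i.
  apply/existsP/idP => [[k /andP[/eqP/hI->]] //|ui].
  by exists i; rewrite eqxx.
have memNh (u : cube m) j : (forall i, h i != j) ->
    [exists k, (h k == j) && u k] = false.
  by move=> hj; apply/existsP => -[k /andP[]]; rewrite (negbTE (hj k)).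
apply/forallP => u; apply/forallP => w; rewrite /hdist.
rewrite -(card_imset _ hI); apply/eqP/eq_card => j; rewrite inE !ffunE.
case: (pickP (fun i => h i == j)) => [i /eqP <-|hj].
  rewrite !memh mem_imset // inE.
  by case: (v _) (u i) (w i) => [] [] [].
have hj' i : h i != j by rewrite hj.
rewrite !memNh // eqxx; apply/esym/imsetP => -[i _ ji].
by have := hj i; rewrite ji eqxx.
Qed.

Definition facemap m n (v : cube n) (h : 'I_m -> 'I_n) (hI : injective h) :
  cubeMap m n := CubeMap (face_isometric v hI).

Definition nodir n (i : 'I_0) : 'I_n := False_rect _ (notF (ltn_ord i)).

Lemma nodir_inj n : injective (@nodir n).
Proof. by case. Qed.

Definition onedir n (i : 'I_n) (_ : 'I_1) : 'I_n := i.

Lemma onedir_inj n (i : 'I_n) : injective (onedir i).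
Proof. by move=> j k _; rewrite (ord1 j) (ord1 k). Qed.

Lemma face_nodir n (v : cube n) u : face_fun v (@nodir n) u = v.
Proof.
by apply/ffunP => j; rewrite !ffunE; case: existsP => [[[]]|]; rewrite ?addbF.
Qed.

Definition cube0 n : cube n := [ffun=> false].
Definition cube1 n : cube n := [ffun=> true].

(* A cube complex is a set of unit cubes glued along isometries of faces.
   An element of [pcell X n] is an n-cell of X together with an isometric
   parametrisation by [0,1]^n, so an n-cell is an orbit of the symmetries of
   [0,1]^n; it may be glued to itself along distinct faces, and distinct cells
   may have the same boundary.  The last axiom says that no cell is folded. *)
Record cubeComplex := CubeComplex {
  pcell :> nat -> Type;
  res : forall m n, cubeMap m n -> pcell n -> pcell m;
  res_id : forall n (c : pcell n), res (idmap n) c = c;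
  res_comp : forall l m n (f : cubeMap m n) (g : cubeMap l m) (c : pcell n),
    res (compmap f g) c = res g (res f c);
  res_free : forall n (f : cubeMap n n) (c : pcell n),
    res f c = c -> f = idmap n }.

Arguments res {_ m n}.

Definition cc_isomorphic (X Y : cubeComplex) :=
  exists F : forall n, X n -> Y n,
    (forall n, bijective (F n)) /\
    (forall m n (f : cubeMap m n) (c : X n), F m (res f c) = res f (F n c)).

Section Cells.
Variable X : cubeComplex.

Definition corner n (c : X n) (v : cube n) : X 0 :=
  res (facemap v (@nodir_inj n)) c.

(* The oriented edge of c issuing from its corner v in direction i. *)
Definition edge_at n (c : X n) (v : cube n) (i : 'I_n) : X 1 :=
  res (facemap v (onedir_inj (i := i))) c.

(* Elements of X 1 are oriented edges. *)
Definition source (e : X 1) : X 0 := corner e (cube0 1).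
Definition target (e : X 1) : X 0 := corner e (cube1 1).
Definition reverse (e : X 1) : X 1 := edge_at e (cube1 1) ord0.

Lemma corner_res m n (f : cubeMap m n) (c : X n) v :
  corner (res f c) v = corner c (f v).
Proof.
rewrite /corner -res_comp; congr (res _ c).
by apply/val_inj/ffunP => u; rewrite [RHS]face_nodir [LHS]ffunE face_nodir.
Qed.

Lemma source_edge_at n (c : X n) v i : source (edge_at c v i) = corner c v.
Proof.
rewrite /source corner_res /=; congr corner; apply/ffunP => j.
rewrite !ffunE; case: existsP => [[k /andP[_]]|]; last by rewrite addbF.
by rewrite ffunE.
Qed.

Lemma edge_at_face m n (c : X n) (h : 'I_m -> 'I_n) (hI : injective h) i :
  edge_at (res (facemap (cube0 n) hI) c) (cube0 m) i =
  edge_at c (cube0 n) (h i).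
Proof.
rewrite /edge_at -res_comp; congr (res _ c).
apply/val_inj/ffunP => u; apply/ffunP => j; rewrite /= !ffunE /=.
apply/existsP/existsP => -[k /andP[/eqP <-]].
  by rewrite !ffunE => /existsP[l /andP[/eqP <- ul]]; exists l; rewrite eqxx.
move=> uk; exists i; rewrite eqxx !ffunE.
by apply/existsP; exists k; rewrite eqxx.
Qed.

(* "An edge incident to x" is read as an oriented edge issuing from x, so that
   a loop contributes two vertices to the link. *)
Definition link_vertex (x : X 0) : set (X 1) := [set e | source e = x].

Definition corner_edges n (c : X n) : set (X 1) :=
  range (edge_at c (cube0 n)).

Definition link_simplex (x : X 0) (s : set (link_vertex x)) :=
  exists n (c : X n), [/\ 0 < n, corner c (cube0 n) = x &
    val @` s = corner_edges c].

Lemma link_simplex_finite x s : @link_simplex x s -> finite_set s.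
Proof.
case=> n [c [_ _ sE]].
have : finite_set (val @` s) by rewrite sE; apply: finite_image; apply: finite_finset.
by rewrite (eq_finite_set (inj_card_eq _)) // => e e' _ _; apply: val_inj.
Qed.

Lemma link_simplex_nonempty x s : @link_simplex x s -> s !=set0.
Proof.
case=> n [c [n0 _ sE]].
have : corner_edges c (edge_at c (cube0 n) (Ordinal n0)) by exists (Ordinal n0).
by rewrite -sE => -[e se _]; exists e.
Qed.

Lemma link_simplex_set1 x (e : link_vertex x) : @link_simplex x [set e].
Proof.
exists 1, (val e); split=> //; first exact: set_mem (valP e).
rewrite image_set1; suff eE : edge_at (val e) (cube0 1) ord0 = val e.
  apply/seteqP; split=> [_ ->|_ [i _ <-]]; first by exists ord0.
  by rewrite (ord1 i) eE.
rewrite /edge_at -[RHS]res_id; congr (res _ _).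
apply/val_inj/ffunP => u; apply/ffunP => j; rewrite /= !ffunE (ord1 j) /=.
by apply/existsP/idP => [[k]|u0]; [rewrite (ord1 k)|exists ord0].
Qed.

Lemma link_simplex_sub x s t :
  @link_simplex x s -> t `<=` s -> t !=set0 -> @link_simplex x t.
Proof.
case=> n [c [n0 cx sE]] ts [e0 te0].
pose I := [set i | `[< exists2 e, t e & val e = edge_at c (cube0 n) i >]]%SET.
have tI e : t e -> exists2 i, i \in I & val e = edge_at c (cube0 n) i.
  move=> te; have : (val @` s) (val e) by exists e => //; apply: ts.
  by rewrite sE => -[i _ ei]; exists i => //; rewrite inE; apply/asboolP; exists e.
exists #|I|, (res (facemap (cube0 n) (@enum_val_inj _ (mem I))) c); split.
- by have [i iI _] := tI _ te0; apply/card_gt0P; exists i.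
- rewrite corner_res -cx; congr corner; apply/ffunP => j /=; rewrite !ffunE /=.
  by apply/existsP => -[k]; rewrite ffunE andbF.
- apply/seteqP; split=> [_ [e te <-]|_ [k _ <-]].
    have [i iI ->] := tI _ te; exists (enum_rank_in iI i) => //.
    by rewrite edge_at_face enum_rankK_in.
  rewrite edge_at_face; have := enum_valP k.
  by rewrite inE => /asboolP[e te <-]; exists e.
Qed.

Definition link x : simplicialComplex :=
  SimplicialComplex (@link_simplex_finite x) (@link_simplex_nonempty x)
    (@link_simplex_set1 x) (@link_simplex_sub x).

(* In general the corners of cells at x form the simplices of a cell complex
   with vertex set [link_vertex x], in which a simplex may have repeated
   vertices and several simplices may have the same vertex set.  It is a
   simplicial complex, and then equal to [link x], when neither happens. *)
Definition link_simplicial (x : X 0) :=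
  (forall n (c : X n), corner c (cube0 n) = x ->
     injective (edge_at c (cube0 n))) /\
  (forall m n (c : X m) (c' : X n),
     corner c (cube0 m) = x -> corner c' (cube0 n) = x ->
     corner_edges c = corner_edges c' ->
     exists (h : 'I_n -> 'I_m) (hI : injective h),
       c' = res (facemap (cube0 m) hI) c).

Fixpoint edge_path (x : X 0) (p : seq (X 1)) (y : X 0) : Prop :=
  if p is e :: p' then source e = x /\ edge_path (target e) p' y else x = y.

Definition cube10 : cube 2 := [ffun i => i == ord0].
Definition cube01 : cube 2 := [ffun i => i == ord_max].

Inductive homotopy_step (x y : X 0) : seq (X 1) -> seq (X 1) -> Prop :=
| homotopy_spur p e q :
    edge_path x (p ++ [:: e; reverse e] ++ q) y ->
    homotopy_step x y (p ++ [:: e; reverse e] ++ q) (p ++ q)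
| homotopy_square p (c : X 2) q :
    let e1 := edge_at c (cube0 2) ord0 in
    let e2 := edge_at c cube10 ord_max in
    let e3 := edge_at c (cube0 2) ord_max in
    let e4 := edge_at c cube01 ord0 in
    edge_path x (p ++ [:: e1; e2] ++ q) y ->
    homotopy_step x y (p ++ [:: e1; e2] ++ q) (p ++ [:: e3; e4] ++ q).

Definition homotopic (x y : X 0) := clos_refl_sym_trans _ (homotopy_step x y).

Definition connected := inhabited (X 0) /\
  forall x y, exists p, edge_path x p y.

(* The fundamental group is the edge-path group of the 2-skeleton. *)
Definition simply_connected := forall x p,
  edge_path x p x -> homotopic x x p [::].

Definition CAT0 := [/\ connected, simply_connected &
  forall x, link_simplicial x /\ flag (link x)].

End Cells.

Definition cube_complex_over (L : simplicialComplex) (X : cubeComplex) :=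
  forall x : X 0, link_simplicial x /\ sc_isomorphic (link x) L.

(* (a, false) stands for the generator a and (a, true) for its inverse. *)
Definition gword (V : Type) := seq ({classic V} * bool).

Section Presentation.
Variables (V : Type) (R : set (gword V)).

Inductive word_step : gword V -> gword V -> Prop :=
| word_cancel u a b v : word_step (u ++ [:: (a, b); (a, ~~ b)] ++ v) (u ++ v)
| word_relator u r v : R r -> word_step (u ++ r ++ v) (u ++ v).

Definition word_eq := clos_refl_sym_trans _ word_step.

Definition word_eqb (u v : gword V) := `[< word_eq u v >].

Lemma word_eqb_refl : reflexive word_eqb.
Proof. by move=> u; apply/asboolP; apply: rst_refl. Qed.

Lemma word_eqb_sym : symmetric word_eqb.
Proof.
by move=> u v; apply/asboolP/asboolP; apply: rst_sym.
Qed.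

Lemma word_eqb_trans : transitive word_eqb.
Proof.
move=> v u w /asboolP uv /asboolP vw; apply/asboolP; exact: rst_trans vw.
Qed.

Canonical word_equiv := EquivRel word_eqb word_eqb_refl word_eqb_sym
  word_eqb_trans.

Definition presGroup := {eq_quot word_equiv}.
HB.instance Definition _ := Choice.on presGroup.
HB.instance Definition _ := EqQuotient.on presGroup.

Definition winv (u : gword V) : gword V :=
  rev [seq (a.1, ~~ a.2) | a <- u].

Definition pg_one : presGroup := \pi_presGroup [::].
Definition pg_mul (g h : presGroup) : presGroup :=
  \pi_presGroup (repr g ++ repr h).
Definition pg_inv (g : presGroup) : presGroup := \pi_presGroup (winv (repr g)).

Lemma pi_word_eq u v : word_eq u v -> \pi_presGroup u = \pi_presGroup v.
Proof. by move=> uv; apply/eqP; rewrite piE; apply/asboolP. Qed.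

Lemma word_eq_repr u : word_eq (repr (\pi_presGroup u)) u.
Proof.
by apply/asboolP; have /eqP := reprK (\pi_presGroup u); rewrite piE.
Qed.

Lemma word_eq_cat2 u u' v v' :
  word_eq u u' -> word_eq v v' -> word_eq (u ++ v) (u' ++ v').
Proof.
move=> uu vv; apply: (@rst_trans _ _ _ (u' ++ v)).
  elim: uu => {u u'} [_ _ [u a b w|u r w Rr]|u|u u' _|u u' w _ uu' _ u'w].
  - by apply: rst_step; rewrite -!catA; apply: word_cancel.
  - by apply: rst_step; rewrite -!catA; apply: word_relator.
  - exact: rst_refl.
  - exact: rst_sym.
  - exact: rst_trans u'w.
elim: vv => {v v'} [_ _ [v a b w|v r w Rr]|v|v v' _|v v' w _ vv' _ v'w].
- by apply: rst_step; rewrite !(catA u' v); apply: word_cancel.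
- by apply: rst_step; rewrite !(catA u' v); apply: word_relator.
- exact: rst_refl.
- exact: rst_sym.
- exact: rst_trans v'w.
Qed.

Lemma winvK : involutive winv.
Proof.
move=> u; rewrite /winv map_rev revK -map_comp.
by rewrite -[RHS]map_id; apply: eq_map => -[a b] /=; rewrite negbK.
Qed.

Lemma word_eq_winvr u : word_eq (u ++ winv u) [::].
Proof.
elim: u => [|[a b] u IHu]; first exact: rst_refl.
rewrite /winv /= rev_cons -cats1 -/(winv u) catA.
apply: (@rst_trans _ _ _ ([:: (a, b)] ++ [::] ++ [:: (a, ~~ b)])).
  rewrite -cat1s -!catA; apply: word_eq_cat2; first exact: rst_refl.
  by rewrite catA; apply: word_eq_cat2 => //; apply: rst_refl.
by apply: rst_step; apply: (@word_cancel [::] a b [::]).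
Qed.

Lemma word_eq_winvl u : word_eq (winv u ++ u) [::].
Proof. by rewrite -{2}[u]winvK; apply: word_eq_winvr. Qed.

Lemma pg_mulA : associative pg_mul.
Proof.
move=> g h k; apply: pi_word_eq.
apply: (@rst_trans _ _ _ (repr g ++ (repr h ++ repr k))).
  by apply: word_eq_cat2; [apply: rst_refl|apply: word_eq_repr].
rewrite catA; apply: word_eq_cat2; last exact: rst_refl.
by apply: rst_sym; apply: word_eq_repr.
Qed.

Lemma pg_mul1 : left_id pg_one pg_mul.
Proof.
move=> g; rewrite -[RHS]reprK; apply: pi_word_eq.
by apply: (@word_eq_cat2 _ [::]); [apply: word_eq_repr|apply: rst_refl].
Qed.

Lemma pg_mulr1 : right_id pg_one pg_mul.
Proof.
move=> g; rewrite -[RHS]reprK; apply: pi_word_eq.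
rewrite -[X in word_eq _ X]cats0.
by apply: word_eq_cat2; [apply: rst_refl|apply: word_eq_repr].
Qed.

Lemma pg_mulV : left_inverse pg_one pg_inv pg_mul.
Proof.
move=> g; apply: pi_word_eq; apply: rst_trans (word_eq_winvl (repr g)).
by apply: word_eq_cat2; [apply: word_eq_repr|apply: rst_refl].
Qed.

Lemma pg_mulrV : right_inverse pg_one pg_inv pg_mul.
Proof.
move=> g; apply: pi_word_eq; apply: rst_trans (word_eq_winvr (repr g)).
by apply: word_eq_cat2; [apply: rst_refl|apply: word_eq_repr].
Qed.

HB.instance Definition _ := isGroup.Build presGroup
  pg_mulA pg_mul1 pg_mulr1 pg_mulV pg_mulrV.

Definition pg_gen (a : V) : presGroup :=
  \pi_presGroup [:: ((a : {classic V}), false)].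

End Presentation.

Section Davis.
Variable L : simplicialComplex.

Inductive racg_relator : set (gword L) :=
| racg_square (a : L) : racg_relator [:: (a, false); (a, false)]
| racg_commutator (a b : L) : adjacent a b ->
    racg_relator [:: (a, true); (b, true); (a, false); (b, false)].

Definition racg := presGroup racg_relator.
HB.instance Definition _ := Group.on racg.

(* The Cayley graph as a simple graph: the two edges joining g and g * a
   that come from a ^+ 2 = 1 are identified. *)
Definition cayley_adj (g h : racg) :=
  exists a : L, h = (g * pg_gen racg_relator a)%g.

End Davis.

Section GraphCubes.
Variables (V : Type) (adj : V -> V -> Prop).

Definition cube_skeleton n : set {ffun cube n -> V} :=
  [set f | injective f /\ forall u v, hdist u v = 1 -> adj (f u) (f v)].

Definition skeleton_fun m n (f : cubeMap m n) (c : {ffun cube n -> V}) :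
  {ffun cube m -> V} := [ffun u => c (f u)].

Lemma hdist0 n (u v : cube n) : hdist u v = 0 -> u = v.
Proof.
move=> /eqP; rewrite cards_eq0 => /eqP uv; apply/ffunP => i; apply/eqP.
by move/setP: uv => /(_ i); rewrite !inE => /negbFE.
Qed.

Lemma cubeMap_inj m n (f : cubeMap m n) : injective f.
Proof.
move=> u v fuv; apply: hdist0; rewrite -(cubeMap_hdist f) fuv.
by apply/eqP; rewrite cards_eq0; apply/eqP/setP => i; rewrite !inE eqxx.
Qed.

Lemma skeleton_funP m n (f : cubeMap m n) (c : @cube_skeleton n) :
  skeleton_fun f (val c) \in @cube_skeleton m.
Proof.
have [cI cadj] := set_mem (valP c); apply/mem_set; split=> [u v|u v uv].
  by rewrite !ffunE => /cI/cubeMap_inj.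
by rewrite !ffunE; apply: cadj; rewrite cubeMap_hdist.
Qed.

Definition graph_res m n (f : cubeMap m n) (c : @cube_skeleton n) :
  @cube_skeleton m := exist (fun g => g \in _) _ (skeleton_funP f c).

Lemma graph_res_id n (c : @cube_skeleton n) : graph_res (idmap n) c = c.
Proof. by apply/val_inj/ffunP => u; rewrite !ffunE. Qed.

Lemma graph_res_comp l m n (f : cubeMap m n) (g : cubeMap l m)
    (c : @cube_skeleton n) :
  graph_res (compmap f g) c = graph_res g (graph_res f c).
Proof. by apply/val_inj/ffunP => u; rewrite !ffunE. Qed.

Lemma graph_res_free n (f : cubeMap n n) (c : @cube_skeleton n) :
  graph_res f c = c -> f = idmap n.
Proof.
move=> /(congr1 val)/ffunP fc; apply/val_inj/ffunP => u; rewrite ffunE.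
have [cI _] := set_mem (valP c).
by apply: cI; have := fc u; rewrite ffunE.
Qed.

(* One n-cube is attached along each subgraph of the simple graph (V, adj)
   isomorphic to the 1-skeleton of an n-cube. *)
Definition graph_cubes : cubeComplex :=
  CubeComplex graph_res_id graph_res_comp graph_res_free.

End GraphCubes.

Definition davis (L : simplicialComplex) : cubeComplex :=
  graph_cubes (@cayley_adj L).

Definition unique_CAT0_over (L : simplicialComplex) (D : cubeComplex) :=
  [/\ CAT0 D, cube_complex_over L D &
    forall X, CAT0 X -> cube_complex_over L X -> cc_isomorphic X D].

(* Main.v *)
From Stdlib Require Import Relation_Operators.
From mathcomp Require Import all_boot.
From mathcomp Require Import boolp classical_sets functions cardinality.
Require Import Defs.

Set Implicit Arguments.
Unset Strict Implicit.
Unset Printing Implicit Defensive.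

Local Open Scope classical_set_scope.
Local Open Scope card_scope.
Local Open Scope quotient_scope.

(** The Davis complex of L is an L-cube-complex in which the edges at every vertex
    are labelled by the vertices of L, opposite sides of squares having the same
    label.

    Suppose that L is superstar-transitive and let X be a CAT(0) L-cube-complex.
    The labelling is carried over to X by developing the Davis complex into X,
    choosing for every element g of the Coxeter group an isomorphism from L onto
    the link of the image of g, by induction on the length of g.  The descents of
    g pairwise commute ([descent2]), so they span a simplex s of L.  The choices
    made at the shorter neighbours of g determine, by transport across squares,
    the isomorphism at g on all simplices meeting s; they agree with one another
    because any two of them are transported from the bottom of a common square.
    What they determine is an isomorphism of open stars, and superstar-transitivity
    extends it to the whole link ([good_chart_exists]).  The developing map so
    obtained is an isomorphism on links, hence a covering, and it is bijective as
    X is simply connected ([base_inj]).  Lengths and descents are studied in the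
    Coxeter group and not in X; the word problem is solved by letting the
    generators act on reduced words modulo commutation.

    Conversely, let phi be an isomorphism from the open star of a simplex s to
    that of s'.  It comes from a permutation m of the vertices of L
    ([star_iso_bijection]).  Consider the subcomplexes of the cube whose corners
    are the functions x from the vertices of L to the booleans.  One of them has
    link L at every corner, and its universal cover is the Davis complex.  Another
    one has the same cells, except in the sector where x vanishes on s, in which
    the simplices of L are renamed by m.  This is coherent, because cells leaving
    the sector correspond to simplices meeting s, and a set of vertices meeting s
    is a simplex if and only if its image under m is one.  Its universal cover [twisted] is again a CAT(0) L-cube-complex.  An
    isomorphism with the Davis complex induces, around the cube spanned by s at a
    corner of the sector, automorphisms of L at all corners but this one, two
    neighbouring automorphisms agreeing on the star of the label of the edge
    between them.  Such an open box of automorphisms can be filled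
    ([filling_exists]), and comparing the filler with the isomorphism at the
    remaining corner yields an automorphism of L extending phi
    ([twisted_extension]).

    Both complexes are built as [unfolding]s: their vertices are words in the
    vertices of L up to cancellation of squares and exchange of letters that
    commute, where the commutation rule may depend on the parities of the letters
    read before.  Connectedness, simple connectivity and the links can be read off
    from this description, for both of them at once. *)

(** * Combinatorial cubes *)

Definition flip n (v : cube n) (i : 'I_n) : cube n :=
  [ffun j => v j (+) (j == i)].

Lemma flipK n (v : cube n) i : flip (flip v i) i = v.
Proof. by apply/ffunP => j; rewrite !ffunE -addbA addbb addbF. Qed.

Lemma flipC n (v : cube n) i j : flip (flip v i) j = flip (flip v j) i.
Proof. by apply/ffunP => k; rewrite !ffunE -!addbA (addbC (k == i)). Qed.

Lemma flip_inj n (v : cube n) : injective (flip v).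
Proof.
move=> i j /ffunP/(_ i); rewrite !ffunE eqxx => /addbI.
by move/esym/eqP.
Qed.

Lemma cube_ind n (P : cube n -> Prop) :
  P (cube0 n) -> (forall v i, P v -> P (flip v i)) -> forall v, P v.
Proof.
move=> P0 PS v.
have [k] := ubnP #|[set i | v i]%SET|; elim: k v => // k IHk v.
have [/eqP|[i]] := set_0Vmem [set i | v i]%SET.
  move=> /eqP/setP v0 _; suff -> : v = cube0 n by [].
  by apply/ffunP => i; have := v0 i; rewrite !inE ffunE.
rewrite inE => vi; rewrite (cardsD1 i) inE vi add1n ltnS => lt_k.
rewrite -(flipK v i); apply/PS/IHk; apply: leq_ltn_trans lt_k.
apply/subset_leq_card/fintype.subsetP => j; rewrite !inE ffunE.
by have [->|] := eqVneq j i; rewrite ?vi //= addbF.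
Qed.

Lemma hdist_flip n (v : cube n) i : hdist v (flip v i) = 1.
Proof.
rewrite /hdist -(cards1 i); apply/eq_card => j; rewrite !inE ffunE.
by case: (v j); case: (j == i).
Qed.

Lemma hdist1 n (u v : cube n) : hdist u v = 1 -> exists i, v = flip u i.
Proof.
move=> /eqP/cards1P[i /setP E]; exists i; apply/ffunP => j; rewrite ffunE.
by have := E j; rewrite !inE => <-; case: (u j); case: (v j).
Qed.

(** An isometry moves opposite edges to edges of one direction: two flips in
    distinct directions span a square, and the remaining corner of a square is
    determined by the other three. *)
Lemma cubeMap_dir m n (f : cubeMap m n) :
  exists h : 'I_m -> 'I_n, forall v i, f (flip v i) = flip (f v) (h i).
Proof.
have dirf v i : exists j, f (flip v i) = flip (f v) j.
  by apply: hdist1; rewrite cubeMap_hdist hdist_flip.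
pose d v i := sval (cid (dirf v i)).
have dP v i : f (flip v i) = flip (f v) (d v i) by rewrite /d; case: cid.
exists (d (cube0 m)).
suff dE v : d v =1 d (cube0 m) by move=> v i; rewrite dP dE.
elim/cube_ind: v => // v j IH i; rewrite -{}IH.
have [<-|ij] := eqVneq i j.
  apply: (@flip_inj _ (f (flip v i))); rewrite -dP flipK dP.
  by rewrite flipK.
have := congr1 f (flipC v j i); rewrite !dP => /ffunP E.
have dij : d v i != d v j.
  apply: contra_neq ij => dij; apply: (@flip_inj _ v).
  by apply: (@cubeMap_inj _ _ f); rewrite !dP dij.
have ndji : d (flip v j) i != d v j.
  apply/eqP => dd; have : f (flip (flip v j) i) = f v by rewrite !dP dd flipK.
  move/cubeMap_inj/ffunP/(_ i); rewrite !ffunE eqxx (negbTE ij).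
  by case: (v i).
have := E (d v i); rewrite !ffunE eqxx (negbTE dij).
rewrite [d v i == _]eq_sym.
have [//|nd] := eqVneq (d (flip v j) i) (d v i).
have := E (d (flip v j) i); rewrite !ffunE eqxx (negbTE nd) (negbTE ndji).
move=> /addbI/esym/eqP ->; rewrite -!addbA => /addbI.
by rewrite eq_sym; case: eqP.
Qed.

Definition dir m n (f : cubeMap m n) : 'I_m -> 'I_n :=
  sval (cid (cubeMap_dir f)).

Lemma dirP m n (f : cubeMap m n) v i : f (flip v i) = flip (f v) (dir f i).
Proof. by rewrite /dir; case: cid. Qed.

Lemma dir_unique m n (f : cubeMap m n) (h : 'I_m -> 'I_n) :
  (forall i, f (flip (cube0 m) i) = flip (f (cube0 m)) (h i)) -> dir f = h.
Proof.
move=> fh; apply/funext => i; apply: (@flip_inj _ (f (cube0 m))).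
by rewrite -dirP fh.
Qed.

Lemma dir_inj m n (f : cubeMap m n) : injective (dir f).
Proof.
move=> i j dij; apply: (@flip_inj _ (cube0 m)); apply: (@cubeMap_inj _ _ f).
by rewrite !dirP dij.
Qed.

Lemma dir_id n : dir (idmap n) = id.
Proof. by apply: dir_unique => i; rewrite !ffunE. Qed.

Lemma dir_comp l m n (f : cubeMap m n) (g : cubeMap l m) :
  dir (compmap f g) = dir f \o dir g.
Proof. by apply: dir_unique => i; rewrite !ffunE !dirP. Qed.

Lemma face_fun0 m n (v : cube n) (h : 'I_m -> 'I_n) :
  face_fun v h (cube0 m) = v.
Proof.
apply/ffunP => j; rewrite !ffunE; case: existsP => [[i]|]; rewrite ?addbF //.
by rewrite ffunE andbF.
Qed.

Lemma face_fun_flip m n (v : cube n) (h : 'I_m -> 'I_n) (w : cube m) i :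
  injective h -> face_fun v h (flip w i) = flip (face_fun v h w) (h i).
Proof.
move=> hI; apply/ffunP => j; rewrite !ffunE -addbA; congr (_ (+) _).
have memh (u : cube m) k : [exists k', (h k' == h k) && u k'] = u k.
  apply/existsP/idP => [[k' /andP[/eqP/hI->]] //|uk].
  by exists k; rewrite eqxx.
case: (pickP (fun k => h k == j)) => [k /eqP <-|hj].
  by rewrite !memh ffunE (inj_eq hI).
have hN (u : cube m) : [exists k', (h k' == j) && u k'] = false.
  by apply/existsP => -[k']; rewrite hj.
by rewrite !hN eq_sym hj.
Qed.

Lemma dir_facemap m n (v : cube n) (h : 'I_m -> 'I_n) (hI : injective h) :
  dir (facemap v hI) = h.
Proof. by apply: dir_unique => i; rewrite /= face_fun_flip. Qed.

Lemma cubeMap_ext m n (f g : cubeMap m n) :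
  f (cube0 m) = g (cube0 m) -> dir f =1 dir g -> f = g.
Proof.
move=> fg0 fgd; apply/val_inj/ffunP => v /=.
by elim/cube_ind: v => // v i IH; rewrite !dirP IH fgd.
Qed.

Lemma facemap_idmap n (h : 'I_n -> 'I_n) (hI : injective h) :
  h =1 id -> facemap (cube0 n) hI = idmap n.
Proof.
move=> hE; apply: cubeMap_ext => /=; first by rewrite face_fun0 ffunE.
by move=> i; rewrite dir_facemap dir_id hE.
Qed.

Section CellEdges.
Variable X : cubeComplex.

Lemma edge_at_res m n (f : cubeMap m n) (c : X n) v i :
  edge_at (res f c) v i = edge_at c (f v) (dir f i).
Proof.
rewrite /edge_at -res_comp; congr (res _ c); apply: cubeMap_ext => /=.
  by rewrite ffunE !face_fun0.
by move=> j; rewrite dir_comp /= !dir_facemap.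
Qed.

Lemma flip_cube0_1 : flip (cube0 1) ord0 = cube1 1.
Proof. by apply/ffunP => j; rewrite !ffunE (ord1 j). Qed.

Lemma flip_cube1_1 : flip (cube1 1) ord0 = cube0 1.
Proof. by apply/ffunP => j; rewrite !ffunE (ord1 j). Qed.

Lemma flip_cube0_2 : flip (cube0 2) ord0 = cube10.
Proof. by apply/ffunP => j; rewrite !ffunE addFb. Qed.

Lemma flip_cube0_2' : flip (cube0 2) ord_max = cube01.
Proof. by apply/ffunP => j; rewrite !ffunE addFb. Qed.

Lemma edge_at_self (e : X 1) : edge_at e (cube0 1) ord0 = e.
Proof.
rewrite /edge_at -[RHS]res_id; congr (res _ e); apply: cubeMap_ext => /=.
  by rewrite face_fun0 ffunE.
by move=> j; rewrite dir_facemap dir_id (ord1 j).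
Qed.

Lemma corner_self (x : X 0) v : corner x v = x.
Proof.
rewrite /corner -[RHS]res_id; congr (res _ x); apply: cubeMap_ext => /=.
  by rewrite face_fun0 ffunE; apply/ffunP => -[].
by case.
Qed.

Lemma target_edge_at n (c : X n) v i :
  target (edge_at c v i) = corner c (flip v i).
Proof.
rewrite /target corner_res -flip_cube0_1 dirP dir_facemap /=.
by rewrite face_fun0.
Qed.

Lemma reverse_edge_at n (c : X n) v i :
  reverse (edge_at c v i) = edge_at c (flip v i) i.
Proof.
by rewrite /reverse edge_at_res -flip_cube0_1 dirP dir_facemap /= face_fun0.
Qed.

Lemma source_reverse (e : X 1) : source (reverse e) = target e.
Proof. by rewrite /reverse source_edge_at. Qed.

Lemma target_reverse (e : X 1) : target (reverse e) = source e.
Proof. by rewrite /reverse target_edge_at flip_cube1_1. Qed.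

Lemma reverseK (e : X 1) : reverse (reverse e) = e.
Proof. by rewrite {2}/reverse reverse_edge_at flip_cube1_1 edge_at_self. Qed.

End CellEdges.

(** * Cube complexes unfolded from local commutation rules *)

Section Unfolding.
Variable T : choiceType.

(** Words record edge paths issuing from a base vertex, the last letter standing
    first.  The rule saying which letters commute may depend on the place that
    has been reached, but only through the parities of the letters read so far:
    these are unchanged when letters are cancelled or exchanged. *)
Definition parity (w : seq T) : T -> bool := fun c => odd (count_mem c w).

Definition pflip (x : T -> bool) (a : T) : T -> bool :=
  fun c => (a == c) (+) x c.

Lemma parity_cons a w : parity (a :: w) = pflip (parity w) a.
Proof. by apply/funext => c; rewrite /parity /pflip /= oddD oddb. Qed.

Lemma pflipK x a : pflip (pflip x a) a = x.
Proof. by apply/funext => c; rewrite /pflip addbA addbb. Qed.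

Lemma pflipC x a b : pflip (pflip x a) b = pflip (pflip x b) a.
Proof. by apply/funext => c; rewrite /pflip addbCA. Qed.

Variable A : (T -> bool) -> T -> T -> Prop.

Inductive weq : seq T -> seq T -> Prop :=
| weq_refl w : weq w w
| weq_sym w w' : weq w w' -> weq w' w
| weq_trans w w' w'' : weq w w' -> weq w' w'' -> weq w w''
| weq_cons a w w' : weq w w' -> weq (a :: w) (a :: w')
| weq_cancel a w : weq (a :: a :: w) w
| weq_swap a b w : A (parity w) a b -> weq (a :: b :: w) (b :: a :: w).

Lemma weq_parity w w' : weq w w' -> parity w = parity w'.
Proof.
elim=> // {w w'} [w w' w'' _ -> //|a w w' _|a w|a b w _].
- by rewrite !parity_cons => ->.
- by rewrite !parity_cons pflipK.
- by rewrite !parity_cons pflipC.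
Qed.

Definition weqb w w' := `[< weq w w' >].

Lemma weqb_refl : reflexive weqb.
Proof. by move=> w; apply/asboolP; apply: weq_refl. Qed.

Lemma weqb_sym : symmetric weqb.
Proof. by move=> w w'; apply/asboolP/asboolP; apply: weq_sym. Qed.

Lemma weqb_trans : transitive weqb.
Proof.
move=> w' w w'' /asboolP h /asboolP h'; apply/asboolP; exact: weq_trans h'.
Qed.

Canonical weq_equiv := EquivRel weqb weqb_refl weqb_sym weqb_trans.

(** The vertices are homotopy classes of paths, as in a universal cover. *)
Definition vert := {eq_quot weq_equiv}.

Definition vclass (w : seq T) : vert := \pi_({eq_quot weq_equiv}) w.

Lemma vclassP w w' : vclass w = vclass w' <-> weq w w'.
Proof.
split=> [/eqP|ww']; first by rewrite /vclass piE => /asboolP.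
by apply/eqP; rewrite /vclass piE; apply/asboolP.
Qed.

Definition vrepr (u : vert) : seq T := repr u.

Lemma vreprK u : vclass (vrepr u) = u.
Proof. exact: reprK. Qed.

Lemma vert_ind (P : vert -> Prop) : (forall w, P (vclass w)) -> forall u, P u.
Proof. by move=> Pw u; rewrite -(vreprK u). Qed.

Lemma weq_vrepr w : weq (vrepr (vclass w)) w.
Proof. by apply/vclassP; rewrite vreprK. Qed.

Definition vpar (u : vert) := parity (vrepr u).

Lemma vpar_vclass w : vpar (vclass w) = parity w.
Proof. exact/weq_parity/weq_vrepr. Qed.

Definition nb (u : vert) (a : T) : vert := vclass (a :: vrepr u).

Lemma nb_vclass w a : nb (vclass w) a = vclass (a :: w).
Proof. exact/vclassP/weq_cons/weq_vrepr. Qed.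

Lemma nbK u a : nb (nb u a) a = u.
Proof.
elim/vert_ind: u => w; rewrite !nb_vclass; exact/vclassP/weq_cancel.
Qed.

Lemma nbC u a b : A (vpar u) a b -> nb (nb u a) b = nb (nb u b) a.
Proof.
elim/vert_ind: u => w; rewrite !nb_vclass vpar_vclass => Aab.
exact/vclassP/weq_sym/weq_swap.
Qed.

Lemma vpar_nb u a : vpar (nb u a) = pflip (vpar u) a.
Proof.
by elim/vert_ind: u => w; rewrite nb_vclass !vpar_vclass parity_cons.
Qed.

Lemma nb_inj u : injective (nb u).
Proof.
move=> a b /(congr1 vpar); rewrite !vpar_nb => /(congr1 (@^~ b)) /=.
by rewrite /pflip eqxx => /addIb/eqP.
Qed.

(** Cells carry both their corners and the labels of their directions; opposite
    edges of a cell thereby share a label. *)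
Record ucell n := UCell {
  ucorner : cube n -> vert;
  ulabel : 'I_n -> T;
  ucornerP : forall v i, ucorner (flip v i) = nb (ucorner v) (ulabel i);
  ucliqueP : forall v i j, i != j ->
    A (vpar (ucorner v)) (ulabel i) (ulabel j) }.

Lemma ucell_ext n (c c' : ucell n) :
  ucorner c (cube0 n) = ucorner c' (cube0 n) -> ulabel c = ulabel c' -> c = c'.
Proof.
case: c c' => [F h FP hP] [F' h' FP' hP'] /= F0 hh'.
case: _ / hh' FP' hP' => FP' hP'.
have FF' : F = F'.
  by apply/funext => v; elim/cube_ind: v => // v i IH; rewrite FP FP' IH.
case: _ / FF' FP' hP' {F0} => FP' hP'.
by congr UCell; apply: Prop_irrelevance.
Qed.

Section Restriction.
Variables (m n : nat) (f : cubeMap m n) (c : ucell n).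

Lemma ures_corner v i : (ucorner c \o f) (flip v i) =
  nb ((ucorner c \o f) v) ((ulabel c \o dir f) i).
Proof. by rewrite /= dirP ucornerP. Qed.

Lemma ures_clique v i j : i != j ->
  A (vpar ((ucorner c \o f) v)) ((ulabel c \o dir f) i) ((ulabel c \o dir f) j).
Proof. by move=> ij; apply: ucliqueP; rewrite (inj_eq (@dir_inj _ _ f)). Qed.

Definition ures : ucell m := UCell ures_corner ures_clique.

End Restriction.

Hypothesis A_irr : forall x a, ~ A x a a.

Lemma ulabel_inj n (c : ucell n) : injective (ulabel c).
Proof.
move=> i j hij; apply/eqP; apply: contrapT => /negP ij.
by have := ucliqueP c (cube0 n) ij; rewrite hij; apply: A_irr.
Qed.

Lemma ucorner_vpar n (c : ucell n) v j : vpar (ucorner c v) (ulabel c j) =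
  v j (+) vpar (ucorner c (cube0 n)) (ulabel c j).
Proof.
elim/cube_ind: v => [|v i IH]; first by rewrite ffunE.
rewrite ucornerP vpar_nb /pflip IH ffunE (inj_eq (@ulabel_inj _ c)).
by rewrite addbA (addbC (v j)) [i == j]eq_sym.
Qed.

Lemma ucorner_inj n (c : ucell n) : injective (ucorner c).
Proof.
move=> v w cvw; apply/ffunP => j; have := ucorner_vpar c v j.
by rewrite cvw ucorner_vpar => /addIb.
Qed.

Lemma ures_id n (c : ucell n) : ures (idmap n) c = c.
Proof. by apply: ucell_ext => /=; rewrite ?ffunE // dir_id. Qed.

Lemma ures_comp l m n (f : cubeMap m n) (g : cubeMap l m) (c : ucell n) :
  ures (compmap f g) c = ures g (ures f c).
Proof. by apply: ucell_ext => /=; rewrite ?ffunE // dir_comp. Qed.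

Lemma ures_free n (f : cubeMap n n) (c : ucell n) : ures f c = c -> f = idmap n.
Proof.
move=> fc; apply: cubeMap_ext.
  apply: (@ucorner_inj _ c); rewrite [RHS]/= ffunE.
  by rewrite -[in RHS]fc.
move=> i; apply: (@ulabel_inj _ c); rewrite dir_id /=.
by rewrite -[in RHS]fc.
Qed.

Definition unfolding : cubeComplex := CubeComplex ures_id ures_comp ures_free.

Hypothesis A_sym : forall x a b, A x a b -> A x b a.
Hypothesis A_flip : forall x a b, A x a b -> A (pflip x a) a b.
Hypothesis A_flip3 : forall x a b c, A x a b -> A x a c -> A x b c ->
  A (pflip x a) b c.

(** Existence of the cube spanned by a clique: flipping the coordinates one
    after the other keeps the clique, hence the order does not matter. *)
Lemma ucell_exists n (u : vert) (h : 'I_n -> T) :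
  (forall i j, i != j -> A (vpar u) (h i) (h j)) ->
  exists c : ucell n, ucorner c (cube0 n) = u /\ ulabel c = h.
Proof.
move=> uh.
pose walk (s : seq 'I_n) (v : cube n) :=
  foldr (fun i u => if v i then nb u (h i) else u) u s.
have clique s v i j : i != j -> A (vpar (walk s v)) (h i) (h j).
  elim: s i j => [|k s IH] /= i j ij; first exact: uh.
  case: (v k); last exact: IH.
  rewrite vpar_nb; have [E|ki] := eqVneq k i.
    by rewrite -E in ij *; apply/A_flip/IH.
  have [E|kj] := eqVneq k j.
    by rewrite -E in ij *; apply/A_sym/A_flip/IH; rewrite eq_sym.
  by apply: A_flip3; apply: IH.
have walkN s v i : i \notin s -> walk s (flip v i) = walk s v.
  elim: s => //= k s IH; rewrite inE negb_or ffunE => /andP[/negbTE ik /IH ->].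
  by rewrite eq_sym ik addbF.
have walk_flip s v i : uniq s -> i \in s ->
    walk s (flip v i) = nb (walk s v) (h i).
  elim: s => //= k s IH /andP[ks us]; rewrite inE ffunE.
  have [-> _|ik] /= := eqVneq i k.
    by rewrite addbT walkN //; case: (v k) => //=; rewrite nbK.
  rewrite addbF => si; rewrite IH //.
  by case: (v k) => //; apply: nbC; apply: clique.
have FP v i : walk (enum 'I_n) (flip v i) = nb (walk (enum 'I_n) v) (h i).
  by apply: walk_flip; rewrite ?enum_uniq ?mem_enum.
exists (UCell FP (clique _)); split=> //=.
by elim: (enum _) => //= k s ->; rewrite ffunE.
Qed.

End Unfolding.

(** * Simplicial complexes and edge paths *)

Lemma adjacent_sym (L : simplicialComplex) (x y : L) :
  adjacent x y -> adjacent y x.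
Proof.
by move=> [xy sxy]; split; [exact/nesym|rewrite setUC].
Qed.

Lemma simplex_adjacent (L : simplicialComplex) (s : set L) x y :
  simplex L s -> s x -> s y -> x <> y -> adjacent x y.
Proof.
move=> Ls sx sy xy; split=> //; apply: simplex_sub Ls _ _.
  by move=> z [] ->.
by exists x; left.
Qed.

Lemma flag_simplexE (L : simplicialComplex) (s : set L) : flag L ->
  simplex L s <-> [/\ finite_set s, s !=set0 &
    forall x y, s x -> s y -> x <> y -> adjacent x y].
Proof.
move=> flagL; split=> [Ls|[]]; last exact: flagL.
split; [exact: simplex_finite Ls|exact: simplex_nonempty Ls|].
by move=> x y; apply: simplex_adjacent.
Qed.

Lemma image_set2 (S S' : Type) (f : S -> S') x y :
  f @` [set x; y] = [set f x; f y].
Proof. by rewrite image_setU !image_set1. Qed.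

Lemma sc_iso_adjacent (K L : simplicialComplex) (f : K -> L) : is_sc_iso f ->
  forall x y, adjacent (f x) (f y) <-> adjacent x y.
Proof.
move=> [fbij fs] x y; rewrite /adjacent -image_set2.
split=> -[xy /fs sxy]; split=> //; first by move=> E; apply: xy; rewrite E.
by move=> /(bij_inj fbij).
Qed.

(** Between flag complexes it suffices to compare 1-skeleta. *)
Lemma flag_sc_iso (K L : simplicialComplex) (f : K -> L) : flag K -> flag L ->
  bijective f -> (forall x y, adjacent (f x) (f y) <-> adjacent x y) ->
  is_sc_iso f.
Proof.
move=> flagK flagL fbij fadj; split=> // s.
have fI := bij_inj fbij.
rewrite !flag_simplexE //; split=> -[sfin [z sz] sadj]; split.
- exact: finite_image.
- by exists (f z); exists z.
- move=> _ _ [x sx <-] [y sy <-] fxy; apply/fadj/sadj => // E.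
  by apply: fxy; rewrite E.
- by move: sfin; rewrite (eq_finite_set (inj_card_eq _)) // => x y _ _ /fI.
- by case: sz => y sy _; exists y.
- move=> x y sx sy xy; apply/fadj/sadj; [by exists x|by exists y|].
  by move=> /fI.
Qed.

Lemma sc_isomorphic_flag (K L : simplicialComplex) :
  sc_isomorphic K L -> flag L -> flag K.
Proof.
move=> [f fiso] flagL s sfin [z sz] sadj.
apply/(proj2 fiso)/flagL; first exact: finite_image.
  by exists (f z); exists z.
move=> _ _ [x sx <-] [y sy <-] fxy.
by apply/(sc_iso_adjacent fiso)/sadj => // E; apply: fxy; rewrite E.
Qed.

Lemma finite_set_enum (S : Type) (s : set S) : finite_set s ->
  exists n (k : 'I_n -> S), injective k /\ range k = s.
Proof.
suff enumE (R : choiceType) (r : seq R) :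
    exists n (k : 'I_n -> R), injective k /\ range k = [set` r].
  by move=> /(@finite_seqP {classic S} s)[r ->]; exact: (enumE {classic S} r).
exists (size (undup r)), (tnth (in_tuple (undup r))); split.
  by apply/tuple_uniqP; rewrite undup_uniq.
apply/seteqP; split=> [_ [i _ <-]|x /= rx].
  by have := mem_tnth i (in_tuple (undup r)); rewrite mem_undup.
have xr : x \in undup r by rewrite mem_undup.
have ir : index x (undup r) < size (undup r) by rewrite index_mem.
by exists (Ordinal ir); rewrite // (tnth_nth x) /= nth_index.
Qed.

Section Paths.
Variable X : cubeComplex.
Implicit Types (x y z : X 0) (p q r : seq (X 1)).

Lemma edge_path_cat x p q y :
  edge_path x (p ++ q) y <-> exists2 z, edge_path x p z & edge_path z q y.
Proof.
elim: p x => [|e p IH] x /=; first by split=> [|[_ <-]] //; exists x.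
split=> [[-> /IH[z pz qz]]|[z [-> pz] qz]]; first by exists z.
by split=> //; apply/IH; exists z.
Qed.

Lemma edge_path_rcons x p e y :
  edge_path x (rcons p e) y <-> edge_path x p (source e) /\ target e = y.
Proof.
rewrite -cats1 edge_path_cat; split=> [[z pz /= [ze ey]]|[pe ey]].
  by rewrite ze.
by exists (source e).
Qed.

Lemma homotopic_catl z r x y p q :
  edge_path z r x -> homotopic x y p q -> homotopic z y (r ++ p) (r ++ q).
Proof.
move=> zr.
elim=> {p q} [_ _ [p e q pq|p c q e1 e2 e3 e4 pq]|p|p q _|p q s _ + _].
- rewrite !catA -!(catA (r ++ p)); apply/rst_step/homotopy_spur.
  by rewrite -catA edge_path_cat; exists x.
- rewrite !(catA r p); apply/rst_step/homotopy_square.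
  by rewrite -catA edge_path_cat; exists x.
- exact: rst_refl.
- exact: rst_sym.
- exact: rst_trans.
Qed.

Lemma homotopic_catr z r x y p q :
  edge_path y r z -> homotopic x y p q -> homotopic x z (p ++ r) (q ++ r).
Proof.
move=> yr.
elim=> {p q} [_ _ [p e q pq|p c q e1 e2 e3 e4 pq]|p|p q _|p q s _ + _].
- rewrite -!catA; apply/rst_step/homotopy_spur.
  by rewrite !catA edge_path_cat; exists y => //; rewrite -!catA.
- rewrite -!catA; apply/rst_step/homotopy_square.
  by rewrite !catA edge_path_cat; exists y => //; rewrite -!catA.
- exact: rst_refl.
- exact: rst_sym.
- exact: rst_trans.
Qed.

Definition rpath p := rev (map (@reverse X) p).

Lemma edge_path_rpath x p y : edge_path x p y -> edge_path y (rpath p) x.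
Proof.
elim: p x => [|e p IH] x /=; first by move=> ->.
move=> [ex /IH py]; rewrite /rpath /= rev_cons edge_path_rcons.
by rewrite source_reverse target_reverse.
Qed.

Lemma homotopic_rpath x p y : edge_path x p y ->
  homotopic y y (rpath p ++ p) [::].
Proof.
elim: p x => [|e p IH] x /=; first by move=> _; apply: rst_refl.
move=> [ex py]; rewrite /rpath /= rev_cons -cats1 -catA -/(rpath p).
apply: rst_trans (IH _ py).
have spur := @homotopy_spur X y y (rpath p) (reverse e) p.
rewrite reverseK in spur; apply/rst_step/spur.
rewrite edge_path_cat; exists (target e); first exact: edge_path_rpath.
by rewrite /= source_reverse target_reverse.
Qed.

Lemma homotopic_cancell x p y q : edge_path x p y -> edge_path y q y ->
  homotopic x y (p ++ q) p -> homotopic y y q [::].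
Proof.
move=> xp yq pq; have yp := edge_path_rpath xp.
apply: (@rst_trans _ _ _ (rpath p ++ p ++ q)).
  rewrite catA; apply: rst_sym.
  exact: (homotopic_catr yq (homotopic_rpath xp)).
apply: rst_trans (homotopic_rpath xp); exact: (homotopic_catl yp pq).
Qed.

End Paths.

(** * Unfoldings are CAT(0) *)

Local Arguments source {X} e : simpl never.
Local Arguments target {X} e : simpl never.
Local Arguments reverse {X} e : simpl never.

Section UnfoldingCells.
Variables (T : choiceType) (A : (T -> bool) -> T -> T -> Prop).
Hypothesis A_irr : forall x a, ~ A x a a.
Hypothesis A_sym : forall x a b, A x a b -> A x b a.
Hypothesis A_flip : forall x a b, A x a b -> A (pflip x a) a b.
Hypothesis A_flip3 : forall x a b c, A x a b -> A x a c -> A x b c ->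
  A (pflip x a) b c.

Local Notation U := (unfolding A_irr).

Definition vertex_of (x : U 0) : vert A := ucorner x (cube0 0).

Definition label_of (e : U 1) : T := ulabel e ord0.

Lemma vertex_of_inj : injective vertex_of.
Proof. by move=> x y xy; apply: ucell_ext => //; apply/funext => -[]. Qed.

Lemma vertex_of_corner n (c : U n) v : vertex_of (corner c v) = ucorner c v.
Proof. by rewrite /vertex_of /= face_fun0. Qed.

Lemma label_of_edge_at n (c : U n) v i : label_of (edge_at c v i) = ulabel c i.
Proof. by rewrite /label_of /= dir_facemap. Qed.

Lemma edge_ext (e e' : U 1) :
  source e = source e' -> label_of e = label_of e' -> e = e'.
Proof.
move=> /(congr1 vertex_of); rewrite !vertex_of_corner => ee' ll'.
by apply: ucell_ext => //; apply/funext => i; rewrite (ord1 i).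
Qed.

Lemma vertex_of_target (e : U 1) :
  vertex_of (target e) = nb (vertex_of (source e)) (label_of e).
Proof. by rewrite !vertex_of_corner -flip_cube0_1 ucornerP. Qed.

Lemma uvertex_exists u : exists x : U 0, vertex_of x = u.
Proof.
have [|c [<- _]] := ucell_exists A_sym A_flip A_flip3 (n := 0) (u := u)
  (h := fun i => False_rect T (notF (ltn_ord i))); last by exists c.
by case.
Qed.

Definition uvertex u : U 0 := sval (cid (uvertex_exists u)).

Lemma vertex_of_uvertex u : vertex_of (uvertex u) = u.
Proof. by rewrite /uvertex; case: cid. Qed.

Lemma uvertex_vertex_of x : uvertex (vertex_of x) = x.
Proof. by apply: vertex_of_inj; rewrite vertex_of_uvertex. Qed.

Lemma uedge_exists u a : exists e : U 1, source e = uvertex u /\ label_of e = a.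
Proof.
have [|c [cu ca]] := ucell_exists A_sym A_flip A_flip3 (n := 1) (u := u)
  (h := fun=> a); first by move=> i j; rewrite (ord1 i) (ord1 j).
exists c; split; last by rewrite /label_of ca.
by apply: vertex_of_inj; rewrite vertex_of_uvertex vertex_of_corner.
Qed.

Definition uedge u a : U 1 := sval (cid (uedge_exists u a)).

Lemma source_uedge u a : source (uedge u a) = uvertex u.
Proof. by rewrite /uedge; case: cid => ? []. Qed.

Lemma label_of_uedge u a : label_of (uedge u a) = a.
Proof. by rewrite /uedge; case: cid => ? []. Qed.

Lemma uedgeE e : e = uedge (vertex_of (source e)) (label_of e).
Proof.
by apply: edge_ext; rewrite ?label_of_uedge // source_uedge uvertex_vertex_of.
Qed.

Lemma target_uedge u a : target (uedge u a) = uvertex (nb u a).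
Proof.
apply: vertex_of_inj; rewrite vertex_of_target vertex_of_uvertex.
by rewrite label_of_uedge source_uedge vertex_of_uvertex.
Qed.

Lemma edge_at_uedge n (c : U n) v i :
  edge_at c v i = uedge (ucorner c v) (ulabel c i).
Proof.
by rewrite [LHS]uedgeE source_edge_at vertex_of_corner label_of_edge_at.
Qed.

Lemma reverse_uedge u a : reverse (uedge u a) = uedge (nb u a) a.
Proof.
apply: edge_ext; first by rewrite source_reverse target_uedge source_uedge.
by rewrite /reverse label_of_edge_at label_of_uedge -/(label_of _)
  label_of_uedge.
Qed.

(** ** Simple connectivity *)

Fixpoint upath (w : seq T) : seq (U 1) :=
  if w is a :: w' then rcons (upath w') (uedge (vclass A w') a) else [::].

Let base : U 0 := uvertex (vclass A [::]).

Lemma edge_path_upath w : edge_path base (upath w) (uvertex (vclass A w)).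
Proof.
elim: w => [//|a w IH]; rewrite [upath _]/= edge_path_rcons source_uedge.
by rewrite target_uedge nb_vclass.
Qed.

(** The relations between words are the elementary homotopies of the unfolding:
    cancelling a letter removes a spur and a swap pushes a path across a
    square. *)
Lemma weq_homotopic w w' : weq A w w' ->
  homotopic base (uvertex (vclass A w)) (upath w) (upath w').
Proof.
elim=> {w w'} [w|w w' ww' IH|w w' w'' ww' IH w'w'' IH'|a w w' ww' IH|a w
  |a b w Aab].
- exact: rst_refl.
- by rewrite -(proj2 (vclassP _ _ _) ww'); apply: rst_sym.
- by apply: rst_trans IH _; rewrite (proj2 (vclassP _ _ _) ww').
- rewrite /= -(proj2 (vclassP _ _ _) ww') -!cats1.
  apply: homotopic_catr IH; split; first exact: source_uedge.
  by rewrite target_uedge nb_vclass.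
- rewrite (proj2 (vclassP _ _ _) (weq_cancel A a w)).
  have := @homotopy_spur U base (uvertex (vclass A w)) (upath w)
    (uedge (vclass A w) a) [::].
  rewrite reverse_uedge nb_vclass !cats0 => spur.
  rewrite [upath (a :: _)]/= -!cats1 -!catA.
  apply/rst_step/spur; rewrite edge_path_cat -nb_vclass -reverse_uedge.
  exists (uvertex (vclass A w)); first exact: edge_path_upath.
  by rewrite /= source_reverse target_reverse source_uedge.
have [|c [cw cab]] := ucell_exists A_sym A_flip A_flip3 (n := 2)
  (u := vclass A w) (h := fun i => if i == ord0 then b else a).
  rewrite vpar_vclass => -[[|[|//]] ?] [[|[|//]] ?] //= _.
  exact: A_sym.
have sq := @homotopy_square U base (uvertex (vclass A (a :: b :: w)))
  (upath w) c [::].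
cbv zeta in sq; rewrite !edge_at_uedge -flip_cube0_2 -flip_cube0_2' in sq.
rewrite !ucornerP cab cw !nb_vclass !cats0 in sq.
rewrite [upath (a :: _)]/= [upath (b :: _)]/= -!cats1 -!catA.
apply/rst_step/sq; rewrite -[[:: _; _]]/([:: _] ++ [:: _]) catA !cats1.
exact: (@edge_path_upath (a :: b :: w)).
Qed.

Lemma upath_cat w p y : edge_path (uvertex (vclass A w)) p y ->
  exists2 w', upath w ++ p = upath w' & y = uvertex (vclass A w').
Proof.
elim: p w => [|e p IH] w /=; first by move=> <-; exists w; rewrite ?cats0.
move=> [ew ep]; have eE : e = uedge (vclass A w) (label_of e).
  by rewrite [LHS]uedgeE ew vertex_of_uvertex.
have [|w' pw' yw'] := IH (label_of e :: w).
  by rewrite -nb_vclass -target_uedge -eE.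
by exists w' => //; rewrite -pw' /= -eE cat_rcons.
Qed.

Lemma unfolding_connected : connected U.
Proof.
split=> [|x y]; first by constructor; exact: base.
have [w <-] : exists w, uvertex (vclass A w) = x.
  by exists (vrepr (vertex_of x)); rewrite vreprK uvertex_vertex_of.
have [w' <-] : exists w', uvertex (vclass A w') = y.
  by exists (vrepr (vertex_of y)); rewrite vreprK uvertex_vertex_of.
exists (rpath (upath w) ++ upath w'); rewrite edge_path_cat; exists base.
  exact/edge_path_rpath/edge_path_upath.
exact: edge_path_upath.
Qed.

(** A loop at the class of w, prefixed by the path w, is the path of a word that
    is equal to w modulo the relations, hence homotopic to w. *)
Lemma unfolding_simply_connected : simply_connected U.
Proof.
move=> x p; have [w <-] : exists w, uvertex (vclass A w) = x.
  by exists (vrepr (vertex_of x)); rewrite vreprK uvertex_vertex_of.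
move=> wp; apply: (homotopic_cancell (edge_path_upath w) wp).
have [w' -> /(congr1 vertex_of)] := upath_cat wp.
rewrite !vertex_of_uvertex => ww'; apply: rst_sym.
by apply: weq_homotopic; apply/vclassP.
Qed.

(** ** Links *)

Lemma unfolding_link_simplicial (x : U 0) : link_simplicial x.
Proof.
split=> [n c cx i j|m n c c' cx c'x cc'].
  move/(congr1 label_of); rewrite !label_of_edge_at; exact: ulabel_inj.
have lab j : exists i, ulabel c' j = ulabel c i.
  have : corner_edges c' (edge_at c' (cube0 n) j) by exists j.
  rewrite -cc' => -[i _ /(congr1 label_of)]; rewrite !label_of_edge_at => E.
  by exists i.
pose h j := sval (cid (lab j)).
have hP j : ulabel c' j = ulabel c (h j) by rewrite /h; case: cid.
have hI : injective h.
  by move=> j k hjk; apply: (@ulabel_inj _ _ A_irr _ c'); rewrite !hP hjk.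
exists h, hI; apply: ucell_ext => /=.
  rewrite face_fun0 -!(vertex_of_corner (n := _)).
  by rewrite cx c'x.
by rewrite dir_facemap; apply/funext => j; rewrite hP.
Qed.

Variables (L : simplicialComplex) (t : (T -> bool) -> T -> L).
Hypothesis flagL : flag L.
Hypothesis t_bij : forall x, bijective (t x).
Hypothesis AE : forall x a b, A x a b <-> adjacent (t x a) (t x b).

(** The simplices of the link at a vertex are the sets of labels pairwise related
    there, and flagness of L recognises their images under t. *)
Lemma unfolding_over : cube_complex_over L U.
Proof.
move=> x; split; first exact: unfolding_link_simplicial.
pose u := vertex_of x.
pose f (e : link x) : L := t (vpar u) (label_of (val e)).
have tI := bij_inj (t_bij (vpar u)).
have srcP (e : link x) : source (val e) = x by exact: set_mem (valP e).
have fI : injective f.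
  by move=> e e' /tI ll'; apply/val_inj/edge_ext; rewrite ?srcP.
exists f; split.
  have [g gK Kg] := t_bij (vpar u).
  have sg a : uedge u (g a) \in link_vertex x.
    by apply/mem_set; rewrite /link_vertex /= source_uedge uvertex_vertex_of.
  exists (fun a => exist (fun e => e \in link_vertex x) _ (sg a)).
    by move=> e; apply: fI; rewrite /f /= label_of_uedge Kg.
  by move=> a; rewrite /f /= label_of_uedge Kg.
move=> s; split=> [[n [c [n0 cx sE]]]|Ls].
  have fsE : f @` s = t (vpar u) @` range (ulabel c).
    rewrite -[f]/((t (vpar u) \o label_of) \o val) -image_comp sE -image_comp.
    congr (_ @` _); apply/seteqP; split=> [_ [_ [i _ <-] <-]|_ [i _ <-]].
      by exists i; rewrite ?label_of_edge_at.
    by exists (edge_at c (cube0 n) i); [exists i|rewrite label_of_edge_at].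
  rewrite fsE; apply: flagL.
  - by apply: finite_image; apply: finite_image; apply: finite_finset.
  - exists (t (vpar u) (ulabel c (Ordinal n0))).
    by exists (ulabel c (Ordinal n0)) => //; exists (Ordinal n0).
  - move=> _ _ [_ [i _ <-] <-] [_ [j _ <-] <-] ij; apply/AE.
    have -> : u = ucorner c (cube0 n) by rewrite -vertex_of_corner cx.
    by apply: ucliqueP; apply: contra_notN ij => /eqP ->.
have [sfin s0 sadj] := (flag_simplexE _ flagL).1 Ls.
have [|n [k [kI ks]]] := @finite_set_enum _ s.
  by move: sfin; rewrite (eq_finite_set (inj_card_eq _)) // => e e' _ _ /fI.
have [i j ij|c [cu cl]] := ucell_exists A_sym A_flip A_flip3 (n := n) (u := u)
    (h := label_of \o val \o k).
  apply/AE; apply: sadj.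
  - by exists (k i) => //; rewrite -ks; exists i.
  - by exists (k j) => //; rewrite -ks; exists j.
  - by move=> /fI/kI; apply/eqP.
have cx : corner (c : U n) (cube0 n) = x.
  by apply: vertex_of_inj; rewrite vertex_of_corner.
exists n, c; split=> //.
  case: s0 => _ [e + _]; rewrite -ks => -[i _ _].
  exact: leq_ltn_trans (leq0n i) (ltn_ord i).
have ckE i : edge_at (c : U n) (cube0 n) i = val (k i).
  by apply: edge_ext; rewrite ?source_edge_at ?cx ?srcP // label_of_edge_at cl.
rewrite -ks; apply/seteqP; split=> [_ [_ [i _ <-] <-]|_ [i _ <-]].
  by exists i => //; rewrite ckE.
by exists (k i); [exists i|rewrite ckE].
Qed.

Lemma unfolding_CAT0 : CAT0 U.
Proof.
split; [exact: unfolding_connected|exact: unfolding_simply_connected|].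
move=> x; split; first exact: unfolding_link_simplicial.
exact: sc_isomorphic_flag (proj2 (unfolding_over x)) flagL.
Qed.

End UnfoldingCells.

(** * Lengths and descents in right-angled Coxeter groups *)

Section Descents.
Variables (T : choiceType) (R : T -> T -> Prop).
Hypothesis R_irr : forall a, ~ R a a.
Hypothesis R_sym : forall a b, R a b -> R b a.

Inductive teq : seq T -> seq T -> Prop :=
| teq_refl w : teq w w
| teq_trans w w' w'' : teq w w' -> teq w' w'' -> teq w w''
| teq_cons a w w' : teq w w' -> teq (a :: w) (a :: w')
| teq_swap a b w : R a b -> teq (a :: b :: w) (b :: a :: w).

Lemma teq_sym w w' : teq w w' -> teq w' w.
Proof.
elim=> {w w'} [w|w w' w'' _ h _ h'|a w w' _ h|a b w Rab].
- exact: teq_refl.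
- exact: teq_trans h.
- exact: teq_cons.
- exact/teq_swap/R_sym.
Qed.

Lemma teq_size w w' : teq w w' -> size w = size w'.
Proof. by elim=> //= {w w'} [w w' w'' _ -> //|a w w' _ ->]. Qed.

(** A letter of a path can be cancelled against its end when it commutes with all
    the letters read after it, that is with those standing before it in w. *)
Fixpoint del (a : T) (w : seq T) : option (seq T) :=
  if w is b :: w' then
    if a == b then Some w'
    else if `[< R a b >] then omap (cons b) (del a w') else None
  else None.

Fixpoint reduced (w : seq T) : bool :=
  if w is a :: w' then ~~ isSome (del a w') && reduced w' else true.

Lemma R_neq a b : R a b -> (a == b) = false.
Proof. by move=> Rab; apply/eqP => E; apply: (@R_irr a); rewrite {2}E. Qed.

Lemma del_adj a b w : R a b -> del a (b :: w) = omap (cons b) (del a w).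
Proof. by move=> Rab /=; rewrite R_neq // (asboolT Rab). Qed.

Lemma del_head a w : del a (a :: w) = Some w.
Proof. by rewrite /= eqxx. Qed.

Lemma del_some a w w' : del a w = Some w' -> teq w (a :: w').
Proof.
elim: w w' => //= b w IH w'; case: eqP => [<- [->]|_]; first exact: teq_refl.
case: asboolP => //= Rab; case: (del a w) IH => //= v IH [<-].
apply: teq_trans (teq_cons b (IH v erefl)) _; exact/teq_swap/R_sym.
Qed.

Definition teq_opt (o o' : option (seq T)) : Prop :=
  match o, o' with
  | Some w, Some w' => teq w w'
  | None, None => True
  | _, _ => False
  end.

Lemma del_teq a w w' : teq w w' -> teq_opt (del a w) (del a w').
Proof.
elim=> {w w'} [w|w w' w'' _ + _|b w w' ww' IH|b c w Rbc].
- by case: (del a w) => //= v; apply: teq_refl.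
- case: (del a w) (del a w') (del a w'') => [u|] [v|] [v'|] //=.
  exact: teq_trans.
- rewrite /=; case: eqP => _ //; case: asboolP => //= _.
  by case: (del a w) (del a w') IH => [u|] [v|] //=; apply: teq_cons.
have Rcb := R_sym Rbc.
have [->|ab] := eqVneq a b.
  by rewrite del_head del_adj // del_head; apply: teq_refl.
have [->|ac] := eqVneq a c.
  by rewrite del_head del_adj // del_head; apply: teq_refl.
rewrite /= (negbTE ab) (negbTE ac); case: asboolP => _; case: asboolP => //= _.
by case: (del a w) => //= v; apply: teq_swap.
Qed.

Lemma del_teqN a w w' : teq w w' -> isSome (del a w) = isSome (del a w').
Proof. by move=> /(del_teq a); case: (del a w) (del a w') => [?|] [?|]. Qed.

Lemma reduced_teq w w' : teq w w' -> reduced w = reduced w'.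
Proof.
elim=> {w w'} [//|w w' w'' _ -> _ //|a w w' ww' /= ->|a b w Rab].
  by rewrite (del_teqN a ww').
have nS (c : T) o : isSome (omap (cons c) o) = isSome o by case: o.
rewrite [LHS]/= [RHS]/= R_neq // (asboolT Rab) R_neq; last exact: R_sym.
by rewrite (asboolT (R_sym Rab)) !nS andbCA.
Qed.

(** The generators act on the reduced words modulo commutation.  This solves the
    word problem: the defining relations hold for the action, so that the normal
    form [nf] below is an invariant, up to commutation. *)
Definition step (a : T) (w : seq T) : seq T := odflt (a :: w) (del a w).

Lemma step_some a w w' : del a w = Some w' -> step a w = w'.
Proof. by rewrite /step => ->. Qed.

Lemma step_none a w : del a w = None -> step a w = a :: w.
Proof. by rewrite /step => ->. Qed.

Lemma del_reduced a w w' : reduced w -> del a w = Some w' ->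
  reduced w' /\ del a w' = None.
Proof.
move=> rw dw; move: rw; rewrite (reduced_teq (del_some dw)) /=.
by case: (del a w') => //= rw'.
Qed.

Lemma step_teq a w w' : teq w w' -> teq (step a w) (step a w').
Proof.
move=> ww'; have := del_teq a ww'; rewrite /step.
by case: (del a w) (del a w') => [u|] [u'|] //= _; apply: teq_cons.
Qed.

Lemma step_reduced a w : reduced w -> reduced (step a w).
Proof.
move=> rw; rewrite /step; case E: (del a w) => [w'|] /=; last by rewrite E.
by have [] := del_reduced rw E.
Qed.

Lemma step_cancel a w : reduced w -> teq (step a (step a w)) w.
Proof.
move=> rw; case E: (del a w) => [w'|].
  have [_ dw'] := del_reduced rw E.
  by rewrite (step_some E) (step_none dw'); apply/teq_sym/del_some.
rewrite (step_none E) (step_some (del_head _ _)); exact: teq_refl.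
Qed.

Lemma step_swap a b w : R a b -> teq (step a (step b w)) (step b (step a w)).
Proof.
wlog E : a b / del a w = None -> del b w = None => [H Rab|Rab].
  case Eb: (del b w) => [v|]; last by apply: H.
  case Ea: (del a w) => [u|]; first by apply: H => //; rewrite Ea.
  by apply/teq_sym/H; [rewrite Eb|apply: R_sym].
have Rba := R_sym Rab; case Ea: (del a w) E => [u|] E; last first.
  rewrite (step_none Ea) (step_none (E erefl)) (step_none (a := a)).
    rewrite (step_none (a := b)); first exact: teq_swap.
    by rewrite del_adj // E.
  by rewrite del_adj // Ea.
case Eb: (del b w) => [v|]; last first.
  rewrite (step_none Eb) (step_some Ea) (step_some (w' := b :: u)).
    rewrite step_none; first exact: teq_refl.
    have := del_teqN b (del_some Ea); rewrite Eb del_adj //.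
    by case: (del b u).
  by rewrite del_adj // Ea.
rewrite (step_some Ea) (step_some Eb).
have := del_teq b (del_some Ea); rewrite Eb del_adj //.
case Eu: (del b u) => [u'|] //= vu'; rewrite (step_some Eu).
apply: teq_trans (step_teq a vu') _.
rewrite (step_some (del_head _ _)); exact: teq_refl.
Qed.

Definition nf (w : seq T) : seq T := foldr step [::] w.

Lemma nf_reduced w : reduced (nf w).
Proof. by elim: w => //= a w; apply: step_reduced. Qed.

Lemma nf_weq w w' : weq (fun=> R) w w' -> teq (nf w) (nf w').
Proof.
elim=> {w w'} [w|w w' _|w w' w'' _ + _|a w w' _|a w|a b w Rab].
- exact: teq_refl.
- exact: teq_sym.
- exact: teq_trans.
- exact: step_teq.
- exact/step_cancel/nf_reduced.
- exact: step_swap.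
Qed.

Local Notation W := (vert (fun=> R)).

Definition len (u : W) : nat := size (nf (vrepr u)).

Definition descent (u : W) (a : T) : Prop := isSome (del a (nf (vrepr u))).

Lemma nf_vclass w : teq (nf (vrepr (vclass (fun=> R) w))) (nf w).
Proof. exact/nf_weq/weq_vrepr. Qed.

Lemma len_vclass w : len (vclass (fun=> R) w) = size (nf w).
Proof. exact/teq_size/nf_vclass. Qed.

Lemma descent_vclass w a :
  descent (vclass (fun=> R) w) a <-> isSome (del a (nf w)).
Proof. by rewrite /descent (del_teqN a (nf_vclass w)). Qed.

Lemma len_descent (u : W) a : descent u a -> len u = (len (nb u a)).+1.
Proof.
elim/vert_ind: u => w /descent_vclass; rewrite nb_vclass !len_vclass /=.
case E: (del a (nf w)) => [v|] // _.
by rewrite (step_some E) (teq_size (del_some E)).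
Qed.

Lemma descent_nb u a : descent (nb u a) a <-> ~ descent u a.
Proof.
elim/vert_ind: u => w; rewrite nb_vclass !descent_vclass /=.
case E: (del a (nf w)) => [v|]; last by rewrite (step_none E) del_head; split.
have [_ dv] := del_reduced (nf_reduced w) E.
by rewrite (step_some E) dv; split.
Qed.

(** If two letters can both be commuted to the end of a reduced word, then one
    of them is commuted past the other. *)
Lemma descent2 u a b : a != b -> descent u a -> descent u b ->
  R a b /\ descent (nb u a) b.
Proof.
elim/vert_ind: u => w ab /descent_vclass da /descent_vclass.
rewrite nb_vclass descent_vclass /=; case E: (del a (nf w)) da => [v|] // _.
rewrite (del_teqN b (del_some E)) (step_some E) /= eq_sym (negbTE ab).
case: asboolP => //= Rba; case: (del b v) => //= _ _.
by split=> //; apply: R_sym.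
Qed.

Lemma len_ascent u a : ~ descent u a -> len (nb u a) = (len u).+1.
Proof. by move=> /descent_nb/len_descent; rewrite nbK. Qed.

(** A vertex of maximal length on a closed path of length four has both its
    neighbours below it. *)
Lemma square_adj (u : W) a b : a != b -> nb (nb u a) b = nb (nb u b) a -> R a b.
Proof.
wlog ba : a b / descent u b -> descent u a => [H|] ab sq.
  have [da|da] := pselect (descent u a); first exact: H.
  by apply/R_sym/H; rewrite 1?eq_sym // => /da.
have [da|da] := pselect (descent u a); last first.
  have db : ~ descent u b by move=> /ba.
  have [r|r] := pselect (descent (nb u a) b).
    by case: (descent2 ab (proj2 (descent_nb _ _) da) r).
  have [s|s] := pselect (descent (nb u b) a).
    by case: (descent2 ab s (proj2 (descent_nb _ _) db)).
  move/descent_nb: r => r; move/descent_nb: s; rewrite -sq => s.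
  by case: (descent2 ab s r).
have [db|db] := pselect (descent u b); first by case: (descent2 ab da db).
suff s : descent (nb u b) a.
  by case: (descent2 ab s (proj2 (descent_nb _ _) db)).
apply: contrapT => s; have := len_ascent s.
rewrite -sq (len_ascent db) (len_descent da) => E.
have [/len_descent|/len_ascent] := pselect (descent (nb u a) b); rewrite E.
  by move=> /eqP; rewrite -addn4 -[X in X == _]addn0 eqn_add2l.
by move=> /eqP; rewrite !eqSS -addn2 -[X in _ == X]addn0 eqn_add2l.
Qed.

End Descents.

(** * Parallel transport of edges *)

Section Transport.
Variable X : cubeComplex.
Hypothesis X_link : forall x : X 0, link_simplicial x /\ flag (link x).

Implicit Types e f : X 1.

Definition spans e e' := exists2 c : X 2,
  edge_at c (cube0 2) ord0 = e & edge_at c (cube0 2) ord_max = e'.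

Definition spanseq e e' := e = e' \/ spans e e'.

Lemma edge_at_inj n (c : X n) v : injective (edge_at c v).
Proof.
pose c' := res (facemap v (@inj_id 'I_n)) c.
have c'E i : edge_at c v i = edge_at c' (cube0 n) i.
  by rewrite edge_at_res dir_facemap /= face_fun0.
move=> i j; rewrite !c'E; exact: (proj1 (proj1 (X_link _)) n c' erefl).
Qed.

Definition two_dirs n (i j : 'I_n) (k : 'I_2) : 'I_n :=
  if k == ord0 then i else j.

Lemma two_dirs_inj n (i j : 'I_n) : i != j -> injective (two_dirs i j).
Proof.
move=> ij [[|[|//]] p] [[|[|//]] q] // E; try exact/val_inj.
  by move: ij; rewrite [i]E eqxx.
by move: ij; rewrite -[i]E eqxx.
Qed.

Lemma square_at n (c : X n) v i j : i != j -> exists c' : X 2,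
  [/\ edge_at c' (cube0 2) ord0 = edge_at c v i,
      edge_at c' (cube0 2) ord_max = edge_at c v j,
      edge_at c' cube10 ord_max = edge_at c (flip v i) j &
      edge_at c' cube01 ord0 = edge_at c (flip v j) i].
Proof.
move=> ij; exists (res (facemap v (two_dirs_inj ij)) c).
rewrite !edge_at_res dir_facemap -flip_cube0_2 -flip_cube0_2' /=.
by rewrite !(face_fun_flip _ _ _ (two_dirs_inj ij)) face_fun0.
Qed.

Lemma cell_spans n (c : X n) v i j : i != j ->
  spans (edge_at c v i) (edge_at c v j).
Proof. by move=> /(square_at c v)[c' [E E' _ _]]; exists c'. Qed.

Lemma spans_source e e' : spans e e' -> source e = source e'.
Proof. by move=> [c <- <-]; rewrite !source_edge_at. Qed.

Lemma spans_sym e e' : spans e e' -> spans e' e.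
Proof. by move=> [c <- <-]; apply: cell_spans. Qed.

Lemma spans_neq e e' : spans e e' -> e <> e'.
Proof. by move=> [c <- <-] /edge_at_inj. Qed.

Lemma spanseq_sym e e' : spanseq e e' -> spanseq e' e.
Proof. by move=> [->|/spans_sym]; [left|right]. Qed.

(** The 1-skeleton of a link is visible on squares alone, since any two edges at a
    corner of a cell span a square face of it. *)
Lemma link_adjacentE x (e e' : link x) :
  adjacent e e' <-> spans (val e) (val e').
Proof.
split=> [[ne [n [c [n0 cx cE]]]]|[c ce ce']].
  have [i ei] : exists i, edge_at c (cube0 n) i = val e.
    have : corner_edges c (val e) by rewrite -cE; exists e => //; left.
    by move=> [i _ <-]; exists i.
  have [j ej] : exists j, edge_at c (cube0 n) j = val e'.
    have : corner_edges c (val e') by rewrite -cE; exists e' => //; right.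
    by move=> [j _ <-]; exists j.
  rewrite -ei -ej; apply: cell_spans.
  by apply: contra_notN ne => /eqP ij; apply: val_inj; rewrite -ei -ej ij.
split.
  move=> ee'; have /spans_neq : spans (val e) (val e') by exists c.
  by rewrite ee'.
exists 2, c; split=> //.
  by rewrite -(source_edge_at c (cube0 2) ord0) ce; exact: set_mem (valP e).
rewrite image_set2 -ce -ce'; apply/seteqP;
  split=> [f [->|->]|f [[[|[|//]] p] _ <-]].
- by exists ord0.
- by exists ord_max.
- by left; congr edge_at; apply: val_inj.
- by right; congr edge_at; apply: val_inj.
Qed.

(** Links being simplicial, a cell is determined by its edges at a corner; the
    reindexing of these edges must be trivial because they are distinct. *)
Lemma cell_unique n (c c' : X n) : corner c (cube0 n) = corner c' (cube0 n) ->
  (forall i, edge_at c (cube0 n) i = edge_at c' (cube0 n) i) -> c = c'.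
Proof.
move=> cc' ee'; have [[inj uniq] _] := X_link (corner c (cube0 n)).
have [|h [hI c'E]] := uniq n n c c' erefl (esym cc').
  by rewrite /corner_edges (_ : edge_at c _ = edge_at c' (cube0 n)) //;
    apply/funext.
have hid : h =1 id.
  move=> i; apply: (inj n c erefl); rewrite -(edge_at_face c hI) -c'E.
  by rewrite ee'.
by rewrite c'E facemap_idmap // res_id.
Qed.

Lemma cell_exists n (s : 'I_n -> X 1) x : (forall i, source (s i) = x) ->
  (forall i j, i != j -> spans (s i) (s j)) ->
  exists c : X n, corner c (cube0 n) = x /\
    forall i, edge_at c (cube0 n) i = s i.
Proof.
move=> sx sadj; case: n s sx sadj => [|n] s sx sadj.
  by exists x; split; [exact: corner_self|case].
have sP i : s i \in link_vertex x by apply/mem_set/sx.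
pose k i : link x := exist (fun e => e \in link_vertex x) _ (sP i).
have /(flag_simplexE _ (proj2 (X_link x))).2 : [/\ finite_set (range k),
    range k !=set0 & forall y z : link x,
      range k y -> range k z -> y <> z -> adjacent y z].
  split; first by apply: finite_image; apply: finite_finset.
    by exists (k ord0), ord0.
  move=> _ _ [i _ <-] [j _ <-] ij; apply/link_adjacentE/sadj.
  by apply: contra_notN ij => /eqP ->.
move=> [m [c [m0 cx cE]]].
have hP i : exists j, edge_at c (cube0 m) j = s i.
  have : corner_edges c (s i) by rewrite -cE; exists (k i) => //; exists i.
  by move=> [j _ <-]; exists j.
pose h i := sval (cid (hP i)).
have hE i : edge_at c (cube0 m) (h i) = s i by rewrite /h; case: cid.
have hI : injective h.
  move=> i j hij; apply/eqP; apply: contrapT => /negP ij.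
  by apply: (spans_neq (sadj i j ij)); rewrite -!hE hij.
exists (res (facemap (cube0 m) hI) c); split.
  by rewrite corner_res /= face_fun0.
by move=> i; rewrite edge_at_face.
Qed.

Lemma cell_of_clique (s : set (X 1)) x : finite_set s ->
  (forall e, s e -> source e = x) ->
  (forall e e', s e -> s e' -> spanseq e e') ->
  exists n (c : X n), corner c (cube0 n) = x /\
    forall e, s e -> exists i, edge_at c (cube0 n) i = e.
Proof.
move=> /finite_set_enum[n [k [kI <-]]] sx sadj.
have [|i j ij|c [cx ck]] := @cell_exists n k x.
- by move=> i; apply: sx; exists i.
- have [||[/kI E]|//] := sadj (k i) (k j); [by exists i|by exists j|].
  by rewrite E eqxx in ij.
by exists n, c; split=> // _ [i _ <-]; exists i.
Qed.

(** Crossing the edge e identifies the star of e in the link at its start with the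
    star of its reverse in the link at its end: the other edges of these stars are
    the pairs of opposite sides of squares containing e. *)
Definition transport e e1 e2 := e1 = e /\ e2 = reverse e \/
  exists c : X 2, [/\ edge_at c (cube0 2) ord0 = e,
    edge_at c (cube0 2) ord_max = e1 & edge_at c cube10 ord_max = e2].

Lemma cell_transport n (c : X n) v i j :
  transport (edge_at c v j) (edge_at c v i) (edge_at c (flip v j) i).
Proof.
have [<-|ij] := eqVneq i j; first by left; rewrite reverse_edge_at.
by right; move: ij; rewrite eq_sym => /(square_at c v)[c' [? ? ? _]]; exists c'.
Qed.

Lemma transport_fun e e1 e2 e2' :
  transport e e1 e2 -> transport e e1 e2' -> e2 = e2'.
Proof.
have N e' e'' (c : X 2) : edge_at c (cube0 2) ord0 = e' ->
    edge_at c (cube0 2) ord_max = e'' -> e' <> e''.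
  by move=> ce ce'; apply: spans_neq; exists c.
move=> [[-> ->]|[c [c0 c1 c2]]] [[+ ->]|[c' [c'0 c'1 c'2]]] //.
- by case: (N _ _ _ c'0 c'1).
- by move=> E; case: (N _ _ _ c0 c1).
- rewrite -c2 -c'2; congr (edge_at _ cube10 ord_max); apply: cell_unique.
    by rewrite -!(source_edge_at _ _ ord0) c0 c'0.
  move=> [[|[|//]] p].
    by rewrite (_ : Ordinal p = ord0) ?c0 ?c'0 //; apply: val_inj.
  by rewrite (_ : Ordinal p = ord_max) ?c1 ?c'1 //; apply: val_inj.
Qed.

Lemma transport_sym e e1 e2 : transport e e1 e2 -> transport (reverse e) e2 e1.
Proof.
move=> [[-> ->]|[c [<- <- <-]]]; first by left; rewrite reverseK.
have := cell_transport c cube10 ord_max ord0.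
by rewrite reverse_edge_at -flip_cube0_2 flipK.
Qed.

Lemma transport_inj e e1 e1' e2 :
  transport e e1 e2 -> transport e e1' e2 -> e1 = e1'.
Proof. by move=> /transport_sym h /transport_sym; apply: transport_fun. Qed.

Lemma transport_spanseq e e1 e2 : transport e e1 e2 -> spanseq e e1.
Proof. by move=> [[-> _]|[c [<- <- _]]]; [left|right; apply: cell_spans]. Qed.

Lemma spanseq_transport e e1 : spanseq e e1 -> exists e2, transport e e1 e2.
Proof.
move=> [<-|[c <- <-]]; first by exists (reverse e); left.
by exists (edge_at c (flip (cube0 2) ord0) ord_max); apply: cell_transport.
Qed.

Lemma spanseq_source e e' : spanseq e e' -> source e' = source e.
Proof. by move=> [->|/spans_source]. Qed.

Lemma transport_source e e1 e2 : transport e e1 e2 -> source e1 = source e.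
Proof. by move=> /transport_spanseq/spanseq_source. Qed.

Lemma transport_target e e1 e2 : transport e e1 e2 -> source e2 = target e.
Proof.
by move=> /transport_sym/transport_source ->; rewrite source_reverse.
Qed.

Lemma transport_self e : transport e e (reverse e).
Proof. by left. Qed.

(** Flagness puts pairwise spanning edges into one cube, where they can be
    transported together. *)
Lemma cube3_at e e1 e2 : spanseq e e1 -> spanseq e e2 -> spanseq e1 e2 ->
  exists n (c : X n) i j k, [/\ edge_at c (cube0 n) i = e,
    edge_at c (cube0 n) j = e1 & edge_at c (cube0 n) k = e2].
Proof.
move=> e01 e02 e12.
have [|f [[->|->]|->]|f f' [[->|->]|->] [[->|->]|->]|n [c [cx cE]]] :=
  @cell_of_clique ([set e; e1] `|` [set e2]) (source e).
- by rewrite !finite_setU.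
- by [].
- exact: spanseq_source.
- exact: spanseq_source.
all: try by left.
all: try by [].
all: try exact: spanseq_sym.
have [i ei] := cE e (or_introl (or_introl erefl)).
have [j ej] := cE e1 (or_introl (or_intror erefl)).
have [k ek] := cE e2 (or_intror erefl).
by exists n, c, i, j, k.
Qed.

Lemma transport_spanseq2 e e1 e2 f1 f2 : transport e e1 f1 ->
  transport e e2 f2 -> spanseq e1 e2 -> spanseq f1 f2.
Proof.
move=> t1 t2 e12.
have [n [c [i [j [k [ei ej ek]]]]]] :=
  cube3_at (transport_spanseq t1) (transport_spanseq t2) e12.
have f1E : f1 = edge_at c (flip (cube0 n) i) j.
  by apply: transport_fun t1 _; rewrite -ei -ej; apply: cell_transport.
have f2E : f2 = edge_at c (flip (cube0 n) i) k.
  by apply: transport_fun t2 _; rewrite -ei -ek; apply: cell_transport.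
rewrite f1E f2E; have [->|jk] := eqVneq j k; first by left.
by right; apply: cell_spans.
Qed.

(** Transport around two sides of a square agrees with transport around the other
    two, because the transported edge spans a cube with this square. *)
Lemma transport_comm e e' b f f' b1 b2 c1 c2 : spanseq e e' ->
  transport e e' f' -> transport e' e f ->
  transport e b b1 -> transport e' b b2 ->
  transport f' b1 c1 -> transport f b2 c2 -> c1 = c2.
Proof.
move=> ee' tf' tf tb1 tb2 tc1 tc2.
have [n [c [i [j [k [ei ej ek]]]]]] :=
  cube3_at ee' (transport_spanseq tb1) (transport_spanseq tb2).
have f'E : f' = edge_at c (flip (cube0 n) i) j.
  by apply: transport_fun tf' _; rewrite -ei -ej; apply: cell_transport.
have fE : f = edge_at c (flip (cube0 n) j) i.
  by apply: transport_fun tf _; rewrite -ei -ej; apply: cell_transport.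
have b1E : b1 = edge_at c (flip (cube0 n) i) k.
  by apply: transport_fun tb1 _; rewrite -ei -ek; apply: cell_transport.
have b2E : b2 = edge_at c (flip (cube0 n) j) k.
  by apply: transport_fun tb2 _; rewrite -ej -ek; apply: cell_transport.
have c1E : c1 = edge_at c (flip (flip (cube0 n) i) j) k.
  by apply: transport_fun tc1 _; rewrite f'E b1E; apply: cell_transport.
apply: transport_fun tc2; rewrite fE b2E c1E flipC; exact: cell_transport.
Qed.

(** ** Charts *)

Variable L : simplicialComplex.

Record chart (x : X 0) (th : L -> X 1) : Prop := Chart {
  chart_source : forall a, source (th a) = x;
  chart_inj : injective th;
  chart_surj : forall e, source e = x -> exists a, th a = e;
  chart_adj : forall a b, adjacent a b <-> spans (th a) (th b) }.

Definition adjeq (a b : L) := a = b \/ adjacent a b.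

Lemma adjeq_refl a : adjeq a a.
Proof. by left. Qed.

Lemma chart_adjeq x th a b : chart x th -> adjeq a b <-> spanseq (th a) (th b).
Proof.
move=> ch; split=> [[->|/(chart_adj ch)]|[/(chart_inj ch) ->|/(chart_adj ch)]].
- by left.
- by right.
- by left.
- by right.
Qed.

Lemma chart_exists (x : X 0) : sc_isomorphic (link x) L ->
  exists th, chart x th.
Proof.
move=> [f fiso]; have [[g fK gK] _] := fiso.
exists (val \o g); split.
- by move=> a; exact: set_mem (valP (g a)).
- by move=> a b /val_inj /(can_inj gK).
- move=> e ex; have eP : e \in link_vertex x by apply/mem_set.
  by exists (f (exist (fun e => e \in link_vertex x) _ eP)); rewrite /= fK.
- move=> a b; rewrite -link_adjacentE.
  by rewrite -{1}(gK a) -{1}(gK b) (sc_iso_adjacent fiso).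
Qed.

(** This condition on the charts at the two ends of the edge labelled a makes
    opposite sides of squares carry the same label. *)
Definition compatible (th th' : L -> X 1) (a : L) :=
  forall b, adjeq a b -> transport (th a) (th b) (th' b).

Lemma compatible_reverse th th' a : compatible th th' a ->
  th' a = reverse (th a).
Proof.
move=> /(_ a (adjeq_refl a)) t; apply: transport_fun t _; exact: transport_self.
Qed.

Lemma compatible_sym th th' a : compatible th th' a -> compatible th' th a.
Proof.
move=> co b ab; rewrite (compatible_reverse co); exact/transport_sym/co.
Qed.

Lemma compatible_target x th th' a : chart x th' -> compatible th th' a ->
  target (th a) = x.
Proof.
move=> ch co; rewrite -source_reverse -(compatible_reverse co).
exact: chart_source ch a.
Qed.

End Transport.

(** * Developing the Davis complex *)

Lemma open_star_sub (L : simplicialComplex) (r t u : set L) :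
  open_star r t -> simplex L u -> t `<=` u -> open_star r u.
Proof.
by move=> [_ [a [ta ra]]] Lu tu; split=> //; exists a; split=> //; apply: tu.
Qed.

Lemma open_star_vertex (L : simplicialComplex) (r : set L) a :
  r a -> open_star r [set a].
Proof. by move=> ra; split; [exact: simplex_set1|exists a]. Qed.

Lemma open_star_self (L : simplicialComplex) (r : set L) :
  simplex L r -> open_star r r.
Proof.
by move=> Lr; split=> //; have [a ra] := simplex_nonempty Lr; exists a.
Qed.

Lemma open_star_adjeq (L : simplicialComplex) (r t : set L) a b :
  open_star r t -> t a -> t b -> adjeq a b.
Proof.
move=> [Lt _] ta tb; have [->|ab] := pselect (a = b); first by left.
by right; apply: simplex_adjacent Lt _ _ _.
Qed.

(** The hypotheses only concern the stars of the single vertices of s.  Injectivity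
    on their union follows: if b and b' have the same image, with b in the star of
    a and b' in the star of a', then a' and b are adjacent or equal, since their
    images are, and hence b also lies in the star of a'. *)
Lemma superstar_extension (L : simplicialComplex) (s : set L) (mu : L -> L) :
  flag L -> superstar_transitive L -> simplex L s ->
  (forall a b c, s a -> adjeq a b -> adjeq a c -> mu b = mu c -> b = c) ->
  (forall a c, s a -> adjeq (mu a) c -> exists2 b, adjeq a b & mu b = c) ->
  (forall a b c, s a -> adjeq a b -> adjeq a c ->
    (adjeq b c <-> adjeq (mu b) (mu c))) ->
  exists2 Phi : L -> L, is_sc_iso Phi &
    forall a b, s a -> adjeq a b -> Phi b = mu b.
Proof.
move=> flagL sst Ls muI muS muE.
have s_adjeq a b : s a -> s b -> adjeq a b.
  move=> sa sb; have [->|ab] := pselect (a = b); first by left.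
  by right; apply: simplex_adjacent Ls _ _ _.
have starP t : open_star s t -> exists2 a, s a & t a.
  by move=> [_ [a [ta sa]]]; exists a.
have muI2 a b a' b' : s a -> s a' -> adjeq a b -> adjeq a' b' -> mu b = mu b' ->
    b = b'.
  move=> sa sa' ab a'b' bb'; apply: (muI a') => //.
  apply: (muE a a' b sa (s_adjeq _ _ sa sa') ab).2; rewrite bb'.
  exact: (muE a' a' b' sa' (adjeq_refl a') a'b').1.
have star_inj t u : open_star s t -> open_star s u ->
    mu @` t `<=` mu @` u -> t `<=` u.
  move=> st su tu b tb; have [a sa ta] := starP _ st.
  have [c uc cb] : (mu @` u) (mu b) by apply: tu; exists b.
  have [a' sa' ua'] := starP _ su.
  suff bc : b = c by rewrite bc.
  apply: (muI2 a b a' c) => //.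
    exact: (open_star_adjeq st).
  exact: (open_star_adjeq su).
have s_star := open_star_self Ls.
have mu_simplex t : open_star s t -> simplex L (mu @` t).
  move=> st; have [a sa ta] := starP _ st; apply: flagL.
  - by apply: finite_image; apply: simplex_finite (proj1 st).
  - by exists (mu a), a.
  - move=> _ _ [x tx <-] [y ty <-] xy.
    have ax := open_star_adjeq st ta tx.
    have ay := open_star_adjeq st ta ty.
    have adjxy : adjeq x y.
      right; apply: simplex_adjacent (proj1 st) tx ty _ => E.
      by apply: xy; rewrite E.
    by case: ((muE a x y sa ax ay).1 adjxy).
have mu_star t : open_star s t -> open_star (mu @` s) (mu @` t).
  move=> st; split; first exact: mu_simplex.
  by have [a sa ta] := starP _ st; exists (mu a); split; exists a.
have mu_iso : is_star_iso s (mu @` s) (fun t => mu @` t).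
  split=> [|t st|t u st su].
  - split=> [t|t u /set_mem st /set_mem su tu|t' [Lt' [x [t'a [a sa aE]]]]].
    + exact: mu_star.
    + by apply/seteqP; split; apply: star_inj => //; rewrite tu.
    subst x.
    have adjt' c : t' c -> adjeq (mu a) c.
      move=> t'c; have [->|ac] := pselect (mu a = c); first by left.
      by right; apply: simplex_adjacent Lt' _ _ _.
    pose t := [set b | adjeq a b /\ t' (mu b)].
    have tE : mu @` t = t'.
      apply/seteqP; split=> [_ [b [_ ?] <-] //|c t'c].
      have [b ab bc] := muS a c sa (adjt' _ t'c).
      by exists b => //; split; rewrite ?bc.
    have ta : t a by split; [left|].
    exists t; rewrite // /open_star /=; split; last by exists a.
    apply: flagL; last 1 first.
    + move=> x y [ax t'x] [ay t'y] xy.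
      have adjxy : adjeq (mu x) (mu y).
        right; apply: simplex_adjacent Lt' t'x t'y _ => /(muI a x y sa ax ay).
        exact: xy.
      by case: ((muE a x y sa ax ay).2 adjxy).
    + have := simplex_finite Lt'; rewrite -tE.
      rewrite (eq_finite_set (inj_card_eq _)) // => x y /set_mem[ax _]
        /set_mem[ay _].
      exact: muI sa ax ay.
    + by exists a.
  - apply: inj_card_eq => x y /set_mem tx /set_mem ty.
    have [a sa ta] := starP _ st.
    by apply: (muI a) => //; apply: open_star_adjeq st _ _.
  - by split=> [|/star_inj]; [exact: image_subset|apply].
have [Phi Phi_iso PhiE] := sst _ _ _ Ls (mu_simplex _ s_star) mu_iso erefl.
have PhiI := bij_inj (proj1 Phi_iso); exists Phi => // a b sa ab.
have Phia : Phi a = mu a.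
  have /PhiE : open_star s [set a] by apply: open_star_vertex.
  by rewrite !image_set1 => E; have : [set Phi a] (Phi a) by []; rewrite E.
case: ab => [<- //|[ab Lab]].
have /PhiE : open_star s [set a; b] by split=> //; exists a; split=> //; left.
rewrite !image_set2 => E; have : [set Phi a; Phi b] (Phi b) by right.
by rewrite E -Phia => -[/PhiI/nesym|].
Qed.

(** Adjacency on the choice type over which words are formed. *)
Definition gen_adj (L : simplicialComplex) (a b : {classic L}) : Prop :=
  @adjacent L a b.

Lemma gen_adj_irr (L : simplicialComplex) (a : {classic L}) : ~ gen_adj a a.
Proof. by case. Qed.

Lemma gen_adj_sym (L : simplicialComplex) (a b : {classic L}) :
  gen_adj a b -> gen_adj b a.
Proof. exact: adjacent_sym. Qed.

Section Development.
Variables (L : simplicialComplex) (X : cubeComplex).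
Hypothesis finL : sc_finite L.
Hypothesis flagL : flag L.
Hypothesis sstL : superstar_transitive L.
Hypothesis X_CAT0 : CAT0 X.
Hypothesis X_over : cube_complex_over L X.

Let X_link (x : X 0) : link_simplicial x /\ flag (link x).
Proof. by have [_ _] := X_CAT0; apply. Qed.

Local Notation W := (vert (fun=> @gen_adj L)).

Definition good_chart (Th : W -> X 0 * (L -> X 1)) (g : W)
    (xth : X 0 * (L -> X 1)) :=
  chart xth.1 xth.2 /\
  forall a, descent g a -> compatible (Th (nb g a)).2 xth.2 a.

Lemma charts_exist x : exists th : L -> X 1, chart x th.
Proof. exact: (chart_exists X_link (proj2 (X_over x))). Qed.

(** The descents of g span a simplex.  The charts at the neighbours of g below
    it prescribe the chart at g on the stars of the vertices of this simplex;
    two of them agree because they are both transported from the chart at the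
    bottom of a square. *)
Lemma good_chart_exists (Th : W -> X 0 * (L -> X 1)) (g : W) :
  (forall h, len h < len g -> good_chart Th h (Th h)) ->
  exists xth, good_chart Th g xth.
Proof.
move=> IH; pose s : set L := [set a | descent g a].
have lt_nb (h : W) a : descent h a -> len (nb h a) < len h.
  by move=> /(len_descent (@gen_adj_irr L) (@gen_adj_sym L)) ->.
pose th a := (Th (nb g a)).2.
have thP a : s a -> chart (Th (nb g a)).1 (th a).
  by move=> sa; case: (IH _ (lt_nb _ _ sa)).
have [s0|/existsNP[a0 /contrapT sa0]] := pselect (forall a, ~ s a).
  have [[[x]] _ _ _] := X_CAT0; have [ch chP] := charts_exist x.
  by exists (x, ch); split=> // a /s0.
have s_adj (a b : {classic L}) : s a -> s b -> a <> b -> gen_adj a b.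
  move=> sa sb /eqP ab.
  by case: (descent2 (@gen_adj_irr L) (@gen_adj_sym L) ab sa sb).
have Ls : simplex L s.
  apply: flagL; [exact: sub_finite_set finL|by exists a0|exact: s_adj].
have agree a a' b e e' : s a -> s a' -> adjeq a b -> adjeq a' b ->
    transport (th a a) (th a b) e -> transport (th a' a') (th a' b) e' ->
    e = e'.
  move=> sa sa' ab a'b te te'.
  have [aa'|aa'] := pselect (a = a').
    by move: te'; rewrite -aa'; apply: transport_fun te.
  have adjaa' := s_adj _ _ sa sa' aa'.
  have neq : (a : {classic L}) != a' by apply/eqP.
  have [_ da'] := descent2 (@gen_adj_irr L) (@gen_adj_sym L) neq sa sa'.
  have a'a : (a' : {classic L}) != a by rewrite eq_sym.
  have [_ da] := descent2 (@gen_adj_irr L) (@gen_adj_sym L) a'a sa' sa.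
  pose th2 := (Th (nb (nb g a) a')).2.
  have co : compatible th2 (th a) a' by apply: (IH _ (lt_nb _ _ sa)).2.
  have co' : compatible th2 (th a') a.
    by rewrite /th2 nbC //; apply: (IH _ (lt_nb _ _ sa')).2.
  have ch2 : chart (Th (nb (nb g a) a')).1 th2.
    by apply: (IH _ _).1; apply: ltn_trans (lt_nb _ _ sa); apply: lt_nb.
  apply: (transport_comm X_link (e := th2 a') (e' := th2 a)) te te'.
  - by apply/(chart_adjeq _ _ ch2); right; apply: gen_adj_sym.
  - by apply: co; right; apply: gen_adj_sym.
  - by apply: co'; right.
  - exact: co.
  - exact: co'.
pose y := target (th a0 a0).
have th_y a : s a -> target (th a a) = y.
  move=> sa; have aa0 : adjeq a a0.
    have [->|E] := pselect (a = a0); first by left.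
    by right; apply: s_adj.
  have [|e te] := @spanseq_transport X (th a a) (th a a0).
    exact/(chart_adjeq _ _ (thP a sa)).
  rewrite -(transport_target te).
  rewrite (agree a a0 a0 _ _ sa sa0 aa0 (adjeq_refl a0) te (transport_self _)).
  exact: source_reverse.
have [la laP] := charts_exist y.
have mu_ex b : exists c, (exists2 a, s a & adjeq a b) ->
    exists a, [/\ s a, adjeq a b & transport (th a a) (th a b) (la c)].
  have [[a sa ab]|N] := pselect (exists2 a, s a & adjeq a b); last by exists b.
  have [|e te] := @spanseq_transport X (th a a) (th a b).
    exact/(chart_adjeq _ _ (thP a sa)).
  have [|c ce] := chart_surj laP (e := e).
    by rewrite (transport_target te) th_y.
  by exists c => _; exists a; rewrite ce.
pose mu b := sval (cid (mu_ex b)).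
have muP a b : s a -> adjeq a b -> transport (th a a) (th a b) (la (mu b)).
  move=> sa ab; rewrite /mu; case: cid => c /= []; first by exists a.
  move=> a' [sa' a'b tc].
  have [|e te] := @spanseq_transport X (th a a) (th a b).
    exact/(chart_adjeq _ _ (thP a sa)).
  by rewrite (agree a' a b _ _ sa' sa a'b ab tc te).
have [|||Phi Phi_iso PhiE] := @superstar_extension L s mu flagL sstL Ls.
- move=> a b c sa ab ac bc; apply: (chart_inj (thP a sa)).
  by apply: (transport_inj X_link (muP a b sa ab)); rewrite bc; apply: muP.
- move=> a c sa; have la_a : la (mu a) = reverse (th a a).
    apply: (transport_fun X_link (muP a a sa (adjeq_refl a))).
    exact: transport_self.
  move=> /(chart_adjeq _ _ laP); rewrite la_a => /spanseq_transport[e te].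
  have te' := transport_sym te; rewrite reverseK in te'.
  have [|b be] := chart_surj (thP a sa) (e := e).
    by rewrite (transport_source te') (chart_source (thP a sa)).
  rewrite -be in te'; have ab : adjeq a b.
    exact/(chart_adjeq _ _ (thP a sa))/(transport_spanseq te').
  exists b => //; apply: (chart_inj laP).
  exact: (transport_fun X_link (muP a b sa ab) te').
- move=> a b c sa ab ac.
  rewrite (chart_adjeq _ _ (thP a sa)) (chart_adjeq _ _ laP).
  have tb := muP a b sa ab; have tc := muP a c sa ac.
  split; first exact: (transport_spanseq2 X_link tb tc).
  apply: (transport_spanseq2 X_link (transport_sym tb)).
  exact: transport_sym.
exists (y, la \o Phi); split=> /=.
  have [[Psi PhiK PsiK] _] := Phi_iso; split.
  - by move=> a; apply: chart_source laP _.
  - by move=> a b /(chart_inj laP)/(can_inj PhiK).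
  - move=> e /(chart_surj laP)[a <-]; exists (Psi a); by rewrite /= PsiK.
  - by move=> a b; rewrite -(chart_adj laP) sc_iso_adjacent.
by move=> a sa b ab /=; rewrite (PhiE a) //; apply: muP.
Qed.

(** The charts are chosen by recursion on the length: the stage n settles the
    vertices of length at most n, so that each vertex is settled after the ends of
    its descents.  Every edge is a descent at one of its two ends. *)
Lemma atlas_exists : exists (f : W -> X 0) (th : W -> L -> X 1),
  (forall g, chart (f g) (th g)) /\
  forall g a, compatible (th g) (th (nb g a)) a.
Proof.
have [[[x]] _ _ _] := X_CAT0; have [th0 th0P] := charts_exist x.
pose choose (Q : X 0 * (L -> X 1) -> Prop) :=
  if pselect (exists q, Q q) is left qP then sval (cid qP) else (x, th0).
have chooseP Q : (exists q, Q q) -> Q (choose Q).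
  by rewrite /choose => qP; case: pselect => // {}qP; case: cid.
pose Th := fix Th n (g : W) := if n is n'.+1 then
  if len g <= n' then Th n' g else choose (good_chart (Th n') g) else (x, th0).
pose th g := Th (len g) g.
have ThE n g : len g <= n -> Th n g = th g.
  elim: n g => [|n IHn] g; first by rewrite /th leqn0 => /eqP ->.
  rewrite leq_eqVlt => /predU1P[gn|]; first by rewrite /th gn.
  by rewrite ltnS /= => gn; rewrite gn IHn.
have thP g : good_chart th g (th g).
  have [n] := ubnP (len g); elim: n g => // n IHn g; rewrite ltnS => gn.
  case gE: (len g) => [|m].
    rewrite /th gE /=; split=> // a /=.
    move=> /(len_descent (@gen_adj_irr L) (@gen_adj_sym L)).
    by rewrite gE.
  have [|q [q1 q2]] := @good_chart_exists th g.
    by move=> h hg; apply: IHn; apply: leq_trans hg gn.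
  have mE a : descent g a -> Th m (nb g a) = th (nb g a).
    by move=> /(len_descent (@gen_adj_irr L) (@gen_adj_sym L));
      rewrite gE => -[->]; rewrite ThE.
  have [|p1 p2] := @chooseP (good_chart (Th m) g).
    by exists q; split=> // a ga; rewrite mE //; apply: q2.
  rewrite /th gE /= gE ltnn; split=> // a ga.
  by have := p2 a ga; rewrite mE.
exists (fun g => (th g).1), (fun g => (th g).2); split=> [g|g a].
  exact: (thP g).1.
have [da|da] := pselect (descent g a).
  exact/(compatible_sym X_link)/(thP g).2.
have := (thP (nb g a)).2 a; rewrite nbK; apply.
exact/(descent_nb (@gen_adj_irr L) (@gen_adj_sym L)).
Qed.

End Development.

(** * The developing map is an isomorphism *)

Definition davis_unfolding (L : simplicialComplex) : cubeComplex :=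
  unfolding (A := fun=> @gen_adj L) (fun=> @gen_adj_irr L).

Section Covering.
Variables (L : simplicialComplex) (X : cubeComplex).
Hypothesis X_CAT0 : CAT0 X.

Let X_link (x : X 0) : link_simplicial x /\ flag (link x).
Proof. by have [_ _] := X_CAT0; apply. Qed.

Local Notation W := (vert (fun=> @gen_adj L)).

Variables (f : W -> X 0) (th : W -> L -> X 1).
Hypothesis thP : forall g, chart (f g) (th g).
Hypothesis th_co : forall g a, compatible (th g) (th (nb g a)) a.

Lemma target_chart g a : target (th g a) = f (nb g a).
Proof. exact: (compatible_target X_link (thP _) (@th_co _ _)). Qed.

Lemma chart_nb g a : th (nb g a) a = reverse (th g a).
Proof. exact: (compatible_reverse X_link (@th_co _ _)). Qed.

Fixpoint lift (g : W) (p : seq (X 1)) (g' : W) : Prop :=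
  if p is e :: p' then exists2 a, th g a = e & lift (nb g a) p' g' else g = g'.

Lemma lift_cat g p q g' :
  lift g (p ++ q) g' <-> exists2 h, lift g p h & lift h q g'.
Proof.
elim: p g => [|e p IH] g /=; first by split=> [|[_ <-]] //; exists g.
split=> [[a ae /IH[h ph qh]]|[h [a ae ph] qh]]; first by exists h => //;
  exists a.
by exists a => //; apply/IH; exists h.
Qed.

Lemma lift_path g p g' : lift g p g' -> edge_path (f g) p (f g').
Proof.
elim: p g => [|e p IH] g /=; first by move=> ->.
move=> [a <- /IH]; rewrite target_chart; split=> //;
  exact: chart_source (thP g) _.
Qed.

Lemma lift_exists g p y : edge_path (f g) p y ->
  exists2 g', lift g p g' & f g' = y.
Proof.
elim: p g => [|e p IH] g /=; first by move=> <-; exists g.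
move=> [/(chart_surj (thP g))[a <-]]; rewrite target_chart => /IH[g' pg' <-].
by exists g' => //; exists a.
Qed.

Lemma edge_path_fun (x y y' : X 0) p :
  edge_path x p y -> edge_path x p y' -> y = y'.
Proof.
elim: p x => [|e p IH] x /=; first by move=> <-.
by move=> [_ py] [_]; apply: IH py.
Qed.

Lemma lift_replace g p s s' q z :
  (forall h, f h = z -> forall k, lift h s k <-> lift h s' k) ->
  edge_path (f g) p z ->
  forall g', lift g (p ++ s ++ q) g' <-> lift g (p ++ s' ++ q) g'.
Proof.
move=> ss' pz g'; rewrite !lift_cat; split=> -[h ph];
  rewrite lift_cat => -[k hk kg].
all: have hz := edge_path_fun (lift_path ph) pz.
all: exists h => //; apply/lift_cat; exists k => //; exact/(ss' h hz).
Qed.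

Lemma lift_spur h e : f h = source e ->
  forall k, lift h [:: e; reverse e] k <-> lift h [::] k.
Proof.
move=> he k; have [a ae] := chart_surj (thP h) (esym he); rewrite -{}ae.
split=> [[a' /(chart_inj (thP h)) -> [b]]|<-].
  by rewrite -chart_nb => /(chart_inj (thP _)) -> /=; rewrite nbK.
by exists a => //; exists a; rewrite ?chart_nb //= nbK.
Qed.

Lemma lift_square h (c : X 2) : f h = corner c (cube0 2) -> forall k,
  lift h [:: edge_at c (cube0 2) ord0; edge_at c cube10 ord_max] k <->
  lift h [:: edge_at c (cube0 2) ord_max; edge_at c cube01 ord0] k.
Proof.
move=> hc k.
have [a ae] := chart_surj (thP h) (e := edge_at c (cube0 2) ord0)
  (etrans (source_edge_at _ _ _) (esym hc)).
have [b be] := chart_surj (thP h) (e := edge_at c (cube0 2) ord_max)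
  (etrans (source_edge_at _ _ _) (esym hc)).
have ab : adjacent a b by apply/(chart_adj (thP h)); exists c.
have ab' : th (nb h a) b = edge_at c cube10 ord_max.
  apply: (transport_fun X_link (@th_co h a b (or_intror ab))).
  by rewrite ae be -flip_cube0_2; apply: cell_transport.
have ba' : th (nb h b) a = edge_at c cube01 ord0.
  apply: (transport_fun X_link (@th_co h b a (or_intror (adjacent_sym ab)))).
  by rewrite ae be -flip_cube0_2'; apply: cell_transport.
have sq : nb (nb h a) b = nb (nb h b) a by apply: nbC.
rewrite -ae -be -ab' -ba'; split=> -[a' /(chart_inj (thP h)) -> [b']].
  move=> /(chart_inj (thP _)) -> /= <-.
  by exists b => //; exists a; rewrite /= -?sq.
move=> /(chart_inj (thP _)) -> /= <-.
by exists a => //; exists b; rewrite /= ?sq.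
Qed.

(** Paths lift uniquely along the charts, and the two ways around a square of X
    lift to the two ways around a square of the Davis complex: the developing map
    is a covering. *)
Lemma lift_homotopic g y p q : homotopic (f g) y p q ->
  forall g', lift g p g' <-> lift g q g'.
Proof.
elim=> {p q} [_ _ [p e q pq|p c q e1 e2 e3 e4 pq]|p|p q _ IH|p q s _ IH _ IH']
  g'.
- move: pq; rewrite edge_path_cat => -[z pz [ez _]].
  rewrite -[q in X in _ <-> X]/([::] ++ q); apply: lift_replace pz _ => h hz.
  by apply: lift_spur; rewrite hz ez.
- move: pq; rewrite edge_path_cat => -[z pz [ez _]].
  apply: lift_replace pz _ => h hz; apply: lift_square.
  by rewrite hz -ez source_edge_at.
- by [].
- by rewrite IH.
- by rewrite IH.
Qed.

Lemma lift_connected g h : exists p, lift g p h.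
Proof.
have tr g1 g2 g3 : (exists p, lift g1 p g2) -> (exists p, lift g2 p g3) ->
    exists p, lift g1 p g3.
  by move=> [p pg] [q qg]; exists (p ++ q); apply/lift_cat; exists g2.
have st k a : exists p, lift k p (nb k a) by exists [:: th k a]; exists a.
pose o : W := vclass (fun=> @gen_adj L) [::].
have og k : (exists p, lift o p k) /\ exists p, lift k p o.
  elim/vert_ind: k; elim=> [|a w [ow wo]]; first by split; exists [::].
  rewrite -nb_vclass; split; first exact: tr ow (st _ _).
  by apply: tr wo; rewrite -{2}(nbK (vclass _ w) a); apply: st.
exact: tr (proj2 (og g)) (proj1 (og h)).
Qed.

(** Two vertices over the same point are joined by a lift of a loop of X, which is
    homotopic to the constant path. *)
Lemma base_inj : injective f.
Proof.
move=> g h gh; have [p pgh] := lift_connected g h.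
have := lift_path pgh; rewrite -gh => loop.
have [_ sc _] := X_CAT0; exact: (lift_homotopic (sc _ _ loop) h).1.
Qed.

Lemma base_surj x : exists g, f g = x.
Proof.
have [[_ conn] _ _] := X_CAT0.
have [p px] := conn (f (vclass (fun=> @gen_adj L) [::])) x.
by have [g _ gx] := lift_exists px; exists g.
Qed.

Lemma develop_exists n (c : davis_unfolding L n) : exists x : X n,
  corner x (cube0 n) = f (ucorner c (cube0 n)) /\
  forall i, edge_at x (cube0 n) i = th (ucorner c (cube0 n)) (ulabel c i).
Proof.
apply: (cell_exists X_link (s := fun i => th _ (ulabel c i))) => [i|i j ij].
  exact: chart_source (thP _) _.
exact/(chart_adj (thP _))/(ucliqueP c (cube0 n) ij).
Qed.

Definition develop n (c : davis_unfolding L n) : X n := sval (cid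
  (develop_exists c)).

Lemma developP n (c : davis_unfolding L n) v :
  corner (develop c) v = f (ucorner c v) /\
  forall i, edge_at (develop c) v i = th (ucorner c v) (ulabel c i).
Proof.
elim/cube_ind: v => [|v j [cv ev]]; first by rewrite /develop; case: cid.
rewrite -target_edge_at ev target_chart ucornerP; split=> // i.
have := cell_transport (develop c) v i j; rewrite !ev => tr.
apply: (transport_fun X_link tr); apply: th_co.
have [->|ij] := eqVneq i j; first by left.
by right; apply: (ucliqueP c v); rewrite eq_sym.
Qed.

Lemma develop_res m n (h : cubeMap m n) (c : davis_unfolding L n) :
  develop (res h c) = res h (develop c).
Proof.
apply: (cell_unique X_link).
  by rewrite (proj1 (developP _ _)) corner_res (proj1 (developP _ _)).
by move=> i; rewrite (proj2 (developP _ _)) edge_at_res (proj2 (developP _ _)).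
Qed.

Lemma develop_inj n : injective (@develop n).
Proof.
move=> c c' cc'; have [c0 ce] := developP c (cube0 n).
have [c'0 c'e] := developP c' (cube0 n).
have uu' : ucorner c (cube0 n) = ucorner c' (cube0 n).
  by apply: base_inj; rewrite -c0 -c'0 cc'.
apply: ucell_ext => //; apply/funext => i.
by apply: (chart_inj (thP (ucorner c (cube0 n)))); rewrite -ce cc' c'e uu'.
Qed.

Lemma develop_surj n (x : X n) : exists c, develop c = x.
Proof.
have [g gx] := base_surj (corner x (cube0 n)).
have lab i : exists a, th g a = edge_at x (cube0 n) i.
  by apply: (chart_surj (thP g)); rewrite source_edge_at.
pose h i : {classic L} := sval (cid (lab i)).
have hP i : th g (h i) = edge_at x (cube0 n) i by rewrite /h; case: cid.
have [||||c [cu cl]] := @ucell_exists _ (fun=> @gen_adj L) _ _ _ n g h.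
- by move=> _; apply: gen_adj_sym.
- by [].
- by [].
- move=> i j ij; apply/(chart_adj (thP g)); rewrite !hP; exact: cell_spans.
exists c; have [c0 ce] := developP c (cube0 n).
apply: (cell_unique X_link) => [|i]; first by rewrite c0 cu.
by rewrite ce cu cl hP.
Qed.

Lemma develop_iso : cc_isomorphic (davis_unfolding L) X.
Proof.
exists develop; split=> [n|m n h c]; last exact: develop_res.
have sec x := cid (@develop_surj n x).
exists (fun x => sval (sec x)) => [c|x]; last by case: (sec x).
by apply: develop_inj; case: (sec _).
Qed.

End Covering.

(** * Invariance under isomorphism *)

Lemma cc_isoP (X Y : cubeComplex) : cc_isomorphic X Y ->
  exists (F : forall n, X n -> Y n) (G : forall n, Y n -> X n),
  [/\ forall n, cancel (F n) (G n), forall n, cancel (G n) (F n),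
      forall m n (f : cubeMap m n) c, F m (res f c) = res f (F n c) &
      forall m n (f : cubeMap m n) c, G m (res f c) = res f (G n c)].
Proof.
move=> [F [Fbij Fres]].
have inv n : exists G, cancel (F n) G /\ cancel G (F n).
  by have [G FK GK] := Fbij n; exists G.
pose G n := sval (cid (inv n)).
have GP n : cancel (F n) (G n) /\ cancel (G n) (F n) by rewrite /G; case: cid.
exists F, G; split=> [n|n|//|m n f c]; [by case: (GP n)|by case: (GP n)|].
have [FK _] := GP m; have [_ GK] := GP n.
by rewrite -{1}(GK c) -Fres FK.
Qed.

Lemma cc_isomorphic_sym X Y : cc_isomorphic X Y -> cc_isomorphic Y X.
Proof.
move=> /cc_isoP[F [G [FK GK _ Gres]]]; exists G; split=> // n.
by exists (F n).
Qed.

Lemma cc_isomorphic_trans X Y Z :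
  cc_isomorphic X Y -> cc_isomorphic Y Z -> cc_isomorphic X Z.
Proof.
move=> [F [Fbij Fres]] [G [Gbij Gres]]; exists (fun n => G n \o F n).
by split=> [n|m n f c]; [apply: bij_comp|rewrite /= Fres Gres].
Qed.

Lemma sc_isomorphic_trans K L M :
  sc_isomorphic K L -> sc_isomorphic L M -> sc_isomorphic K M.
Proof.
move=> [f [fbij fs]] [g [gbij gs]]; exists (g \o f).
by split=> [|s]; [apply: bij_comp|rewrite fs gs image_comp].
Qed.

Section Morphism.
Variables (X Y : cubeComplex) (F : forall n, X n -> Y n).
Hypothesis Fres : forall m n (f : cubeMap m n) c, F (res f c) = res f (F c).

Lemma mor_corner n (c : X n) v : F (corner c v) = corner (F c) v.
Proof. exact: Fres. Qed.

Lemma mor_edge_at n (c : X n) v i : F (edge_at c v i) = edge_at (F c) v i.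
Proof. exact: Fres. Qed.

Lemma mor_source (e : X 1) : F (source e) = source (F e).
Proof. exact: Fres. Qed.

Lemma mor_target (e : X 1) : F (target e) = target (F e).
Proof. exact: Fres. Qed.

Lemma mor_reverse (e : X 1) : F (reverse e) = reverse (F e).
Proof. exact: Fres. Qed.

Lemma mor_edge_path (x y : X 0) p :
  edge_path x p y -> edge_path (F x) (map (@F 1) p) (F y).
Proof.
elim: p x => [|e p IH] x /=; first by move=> ->.
by move=> [<- /IH]; rewrite mor_source mor_target.
Qed.

Lemma mor_homotopic (x y : X 0) p q :
  homotopic x y p q -> homotopic (F x) (F y) (map (@F 1) p) (map (@F 1) q).
Proof.
elim=> {p q} [_ _ [p e q|p c q e1 e2 e3 e4]|p|p q _|p q s _ + _].
- move=> /mor_edge_path; rewrite !map_cat /= mor_reverse => pq.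
  exact/rst_step/homotopy_spur.
- move=> /mor_edge_path; rewrite /e1 /e2 /e3 /e4 !map_cat /= !mor_edge_at => pq.
  exact/rst_step/homotopy_square.
- exact: rst_refl.
- exact: rst_sym.
- exact: rst_trans.
Qed.

Lemma mor_corner_edges n (c : X n) : @F 1 @` corner_edges c = corner_edges (F
  c).
Proof.
apply/seteqP; split=> [_ [_ [i _ <-] <-]|_ [i _ <-]].
  by exists i => //; rewrite mor_edge_at.
by exists (edge_at c (cube0 n) i); [exists i|rewrite mor_edge_at].
Qed.

End Morphism.

Section IsoInvariance.
Variables (X Y : cubeComplex).
Variables (F : forall n, X n -> Y n) (G : forall n, Y n -> X n).
Hypothesis FK : forall n, cancel (@F n) (@G n).
Hypothesis GK : forall n, cancel (@G n) (@F n).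
Hypothesis Fres : forall m n (f : cubeMap m n) c, F (res f c) = res f (F c).
Hypothesis Gres : forall m n (f : cubeMap m n) c, G (res f c) = res f (G c).

Let GI n : injective (@G n) := can_inj (@GK n).

Lemma iso_connected : connected X -> connected Y.
Proof.
move=> [[x] conn]; split=> [|y y']; first by constructor; exact: F x.
have [p py] := conn (G y) (G y'); exists (map (@F 1) p).
by have := mor_edge_path Fres py; rewrite !GK.
Qed.

Lemma iso_simply_connected : simply_connected X -> simply_connected Y.
Proof.
move=> sc y p /(mor_edge_path Gres)/sc/(mor_homotopic Fres).
by rewrite !GK (mapK (@GK 1)).
Qed.

Lemma iso_link_simplicial y : link_simplicial (G y) -> link_simplicial y.
Proof.
move=> [inj uniq]; split=> [n c cy i j|m n c c' cy c'y cc'].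
  move=> /(congr1 (@G 1)); rewrite !(mor_edge_at Gres).
  by apply: inj; rewrite -(mor_corner Gres) cy.
have [|||h [hI c'E]] := uniq m n (G c) (G c').
- by rewrite -(mor_corner Gres) cy.
- by rewrite -(mor_corner Gres) c'y.
- by rewrite -!(mor_corner_edges Gres) cc'.
- by exists h, hI; apply: GI; rewrite Gres.
Qed.

Lemma iso_link y : sc_isomorphic (link y) (link (G y)).
Proof.
have GP (e : link y) : G (val e) \in link_vertex (G y).
  by apply/mem_set; rewrite /link_vertex /= -(mor_source Gres) (set_mem (valP
    e)).
have FP (e : link (G y)) : F (val e) \in link_vertex y.
  apply/mem_set; rewrite /link_vertex /= -(mor_source Fres) (set_mem (valP e)).
  exact: GK.
pose Gl e : link (G y) := exist (fun e => e \in link_vertex (G y)) _ (GP e).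
pose Fl e : link y := exist (fun e => e \in link_vertex y) _ (FP e).
have GlK : cancel Gl Fl by move=> e; apply: val_inj; apply: GK.
have FlK : cancel Fl Gl by move=> e; apply: val_inj; apply: FK.
have valGl s : val @` (Gl @` s) = @G 1 @` (val @` s) by rewrite !image_comp.
exists Gl; split; [by exists Fl|move=> s].
split=> -[n [c [n0 cy sE]]].
  exists n, (G c); split=> //; first by rewrite -(mor_corner Gres) cy.
  by rewrite valGl sE (mor_corner_edges Gres).
exists n, (F c); split=> //; first by rewrite -(mor_corner Fres) cy GK.
rewrite -(mor_corner_edges Fres) -sE valGl (image_comp (@G 1)).
rewrite (_ : @F 1 \o @G 1 = id) ?image_id //.
by apply/funext => e; apply: GK.
Qed.

End IsoInvariance.

Lemma cc_isomorphic_over L X Y : cc_isomorphic X Y ->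
  cube_complex_over L X -> cube_complex_over L Y.
Proof.
move=> /cc_isoP[F [G [FK GK Fres Gres]]] overX y.
have [ls iso] := overX (G _ y); split.
  exact: iso_link_simplicial GK Gres _ ls.
exact: sc_isomorphic_trans (iso_link FK GK Fres Gres y) iso.
Qed.

Lemma cc_isomorphic_CAT0 X Y : cc_isomorphic X Y -> CAT0 X -> CAT0 Y.
Proof.
move=> /cc_isoP[F [G [FK GK Fres Gres]]] [conn sc lk]; split.
- exact: iso_connected GK Fres conn.
- exact: iso_simply_connected GK Fres Gres sc.
- move=> y; have [ls fl] := lk (G _ y); split.
    exact: iso_link_simplicial GK Gres _ ls.
  exact: sc_isomorphic_flag (iso_link FK GK Fres Gres y) fl.
Qed.

(** * The Davis complex as an unfolding *)

Section DavisUnfolding.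
Variable L : simplicialComplex.

Local Notation T := {classic L}.
Local Notation W := (vert (fun=> @gen_adj L)).
Local Notation cls := (vclass (fun=> @gen_adj L)).
Local Notation R := (@racg_relator L).

Definition forget (u : gword L) : seq T := rev (map fst u).

Lemma forget_cat u v : forget (u ++ v) = forget v ++ forget u.
Proof. by rewrite /forget map_cat rev_cat. Qed.

Lemma weq_catl (w v v' : seq T) : weq (fun=> @gen_adj L) v v' ->
  weq (fun=> @gen_adj L) (w ++ v) (w ++ v').
Proof. by move=> vv'; elim: w => //= a w; apply: weq_cons. Qed.

Lemma forget_word_eq u v : word_eq R u v ->
  weq (fun=> @gen_adj L) (forget u) (forget v).
Proof.
elim=> {u v} [_ _ [u a b v|u _ v [a|a b ab]]|u|u v _|u v w _ + _].
- rewrite !forget_cat -catA; exact/weq_catl/weq_cancel.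
- rewrite !forget_cat -catA; exact/weq_catl/weq_cancel.
- rewrite !forget_cat -catA; apply: weq_catl.
  rewrite -[forget [:: _; _; _; _] ++ _]/(b :: a :: b :: a :: forget u).
  apply: (@weq_trans T _ _ (b :: b :: a :: a :: forget u)).
    exact/weq_cons/weq_swap.
  apply: weq_trans (@weq_cancel T _ b _) _; exact: weq_cancel.
- exact: weq_refl.
- exact: weq_sym.
- exact: weq_trans.
Qed.

Definition signed (w : seq T) : gword L := rev [seq (a, false) | a <- w].

Lemma signed_cons a w : signed (a :: w) = signed w ++ [:: (a, false)].
Proof. by rewrite /signed /= rev_cons cats1. Qed.

Lemma signed_weq w w' : weq (fun=> @gen_adj L) w w' ->
  word_eq R (signed w) (signed w').
Proof.
elim=> {w w'} [w|w w' _|w w' w'' _ + _|a w w' _|a w|a b w ab].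
- exact: rst_refl.
- exact: rst_sym.
- exact: rst_trans.
- rewrite !signed_cons => ww'; apply: word_eq_cat2 => //; exact: rst_refl.
- rewrite !signed_cons -catA -[X in word_eq R _ X]cats0.
  apply/rst_step; rewrite -[X in word_step _ _ (_ ++ X)]cat0s.
  rewrite -[[:: (a, false)] ++ _]cats0.
  by apply: word_relator; apply: (racg_square a).
rewrite !signed_cons -!catA; apply: word_eq_cat2; first exact: rst_refl.
(* Append the commutator of a and b to the word ba, and cancel. *)
apply: (@rst_trans _ _ _ [:: (b, false); (a, false); (a, true); (b, true);
  (a, false); (b, false)]).
  apply/rst_sym/rst_step.
  exact: (word_relator [:: (b, false); (a, false)] [::]
    (racg_commutator ab)).
apply: (@rst_trans _ _ _ [:: (b, false); (b, true); (a, false); (b, false)]).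
  apply/rst_step.
  exact: (word_cancel _ [:: (b, false)] a false
    [:: (b, true); (a, false); (b, false)]).
by apply/rst_step/(word_cancel _ [::] b false [:: (a, false); (b, false)]).
Qed.

Lemma signed_forget u : word_eq R (signed (forget u)) u.
Proof.
rewrite /signed /forget map_rev revK -map_comp.
elim: u => [|[a b] u IH] /=; first exact: rst_refl.
rewrite -cat1s -[(a, b) :: u]cat1s; apply: word_eq_cat2 => //.
case: b; last exact: rst_refl.
apply: (@rst_trans _ _ _ [:: (a, true); (a, false); (a, false)]).
  by apply/rst_sym/rst_step/(word_cancel _ [::] a true [:: (a, false)]).
by apply/rst_step/(word_relator [:: (a, true)] [::] (racg_square a)).
Qed.

Lemma forget_signed w : forget (signed w) = w.
Proof. by rewrite /signed /forget map_rev revK -map_comp map_id. Qed.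

(** Elements of the group and vertices of the unfolding are classes of words for
    the same relations; signs are immaterial as the generators are involutions. *)
Definition racg_vert (g : racg L) : W := cls (forget (repr g)).

Definition vert_racg (u : W) : racg L := \pi_(presGroup R) (signed (vrepr u)).

Lemma racg_vert_pi u : racg_vert (\pi_(presGroup R) u) = cls (forget u).
Proof. exact/vclassP/forget_word_eq/word_eq_repr. Qed.

Lemma racg_vertK : cancel racg_vert vert_racg.
Proof.
move=> g; rewrite -[RHS]reprK; apply: pi_word_eq.
apply: rst_trans (signed_forget (repr g)); exact/signed_weq/weq_vrepr.
Qed.

Lemma vert_racgK : cancel vert_racg racg_vert.
Proof. by move=> u; rewrite racg_vert_pi forget_signed vreprK. Qed.

Lemma racg_vert_gen (g : racg L) (a : L) :
  racg_vert (g * pg_gen R a)%g = nb (racg_vert g) a.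
Proof.
rewrite -[(_ * _)%g]/(pg_mul g (pg_gen R a)) racg_vert_pi forget_cat nb_vclass.
have /forget_word_eq : word_eq R (repr g ++ repr (pg_gen R a))
    (repr g ++ [:: (a, false)]).
  by apply: word_eq_cat2; [exact: rst_refl|exact: word_eq_repr].
by rewrite !forget_cat => /vclassP.
Qed.

Lemma cayley_adjE (g h : racg L) :
  cayley_adj g h <-> exists a : T, racg_vert h = nb (racg_vert g) a.
Proof.
split=> [[a ->]|[a ha]]; exists a; first by rewrite racg_vert_gen.
by apply: (can_inj racg_vertK); rewrite racg_vert_gen.
Qed.

Lemma skeleton_of_cellP n (c : davis_unfolding L n) :
  [ffun v => vert_racg (ucorner c v)] \in @cube_skeleton _ (@cayley_adj L) n.
Proof.
apply/mem_set; split=> [u v|u v /hdist1[i ->]]; rewrite !ffunE.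
  move=> /(can_inj vert_racgK).
  exact: (@ucorner_inj _ _ (fun=> @gen_adj_irr L) _ c).
by apply/cayley_adjE; exists (ulabel c i); rewrite !vert_racgK ucornerP.
Qed.

Definition skeleton_of_cell n (c : davis_unfolding L n) : davis L n :=
  exist (fun f => f \in _) _ (skeleton_of_cellP c).

Lemma skeleton_of_cell_inj n : injective (@skeleton_of_cell n).
Proof.
move=> c c' /(congr1 val)/ffunP E.
have cc' v : ucorner c v = ucorner c' v.
  by apply: (can_inj vert_racgK); have := E v; rewrite !ffunE.
apply: ucell_ext => //; apply/funext => i.
by apply: (@nb_inj _ _ (ucorner c (cube0 n))); rewrite -ucornerP !cc' ucornerP.
Qed.

(** Parallel edges of the skeleton of a cube carry the same generator: in a
    square of the Cayley graph the parities of the generators force opposite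
    edges to agree, since adjacent corners are distinct. *)
Lemma skeleton_of_cell_surj n (d : davis L n) :
  exists c, skeleton_of_cell c = d.
Proof.
have [dI dadj] := set_mem (valP d); pose F v : W := racg_vert (val d v).
have FI : injective F by move=> u v /(can_inj racg_vertK)/dI.
have lab v i : exists a : T, F (flip v i) = nb (F v) a.
  by apply/cayley_adjE/dadj/hdist_flip.
pose a v i := sval (cid (lab v i)).
have aP v i : F (flip v i) = nb (F v) (a v i) by rewrite /a; case: cid.
have a_flip v i j : a (flip v j) i = a v i.
  have [->|ij] := eqVneq i j.
    by apply: (@nb_inj _ _ (F (flip v j))); rewrite -aP flipK aP nbK.
  have neq : a v i != a v j.
    by apply: contra_neq ij => E; apply: (@flip_inj _ v); apply: FI;
      rewrite !aP E.
  have sq : nb (nb (F v) (a v j)) (a (flip v j) i) =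
      nb (nb (F v) (a v i)) (a (flip v i) j) by rewrite -!aP flipC.
  have := congr1 (fun x => vpar x (a v i)) sq.
  rewrite !vpar_nb /pflip eqxx [a v j == _]eq_sym (negbTE neq) /=.
  case: eqP => // _; case: eqP => [E _|_].
    have : F (flip (flip v i) j) = F v by rewrite !aP E nbK.
    move=> /FI/ffunP/(_ i); rewrite !ffunE eqxx (negbTE ij).
    by case: (v i).
  by case: (vpar _ _).
pose h i := a (cube0 n) i.
have aE v i : a v i = h i by elim/cube_ind: v => // v j <-; rewrite a_flip.
have FP v i : F (flip v i) = nb (F v) (h i) by rewrite aP aE.
have clique (v : cube n) i j : i != j -> gen_adj (h i) (h j).
  move=> ij; apply: (@square_adj T _ (@gen_adj_irr L) (@gen_adj_sym L)
    (F v)).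
    by apply: contra_neq ij => E; apply: (@flip_inj _ v); apply: FI;
      rewrite !FP E.
  by rewrite -!FP flipC.
exists (UCell FP clique); apply/val_inj/ffunP => v.
by rewrite ffunE /= racg_vertK.
Qed.

Lemma davis_unfolding_iso : cc_isomorphic (davis_unfolding L) (davis L).
Proof.
exists skeleton_of_cell; split=> [n|m n f c]; last first.
  by apply/val_inj/ffunP => v; rewrite !ffunE.
have sec d := cid (@skeleton_of_cell_surj n d).
exists (fun d => sval (sec d)) => [c|d]; last by case: (sec d).
by apply: skeleton_of_cell_inj; case: (sec _).
Qed.

Hypothesis flagL : flag L.

Lemma davis_unfolding_CAT0 : CAT0 (davis_unfolding L).
Proof.
apply: (@unfolding_CAT0 T (fun=> @gen_adj L) (fun=> @gen_adj_irr L)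
  _ _ _ L (fun=> id)) => //.
- by move=> _; apply: gen_adj_sym.
- by move=> _; exists id.
Qed.

Lemma davis_unfolding_over : cube_complex_over L (davis_unfolding L).
Proof.
apply: (@unfolding_over T (fun=> @gen_adj L) (fun=> @gen_adj_irr L)
  _ _ _ L (fun=> id)) => //.
- by move=> _; apply: gen_adj_sym.
- by move=> _; exists id.
Qed.

End DavisUnfolding.

(** * Isomorphisms of open stars and vertex bijections *)

(** As long as a point is missing from the domain, one is missing from the image;
    they are matched one pair at a time. *)
Lemma extend_inj_fin (I : finType) (A : {set I}) (f : I -> I) :
  {in A &, injective f} ->
  exists g : I -> I, bijective g /\ {in A, f =1 g}.
Proof.
have [k] := ubnP #|~: A|%SET; elim: k A f => // k IHk A f Ak fI.
have [A0|[x]] := set_0Vmem (~: A)%SET.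
  exists f; split=> //; apply: injF_bij => x y.
  have inA z : z \in A by have /setP/(_ z) := A0; rewrite !inE => /negbFE.
  exact: fI.
rewrite inE => xA.
have [y yA] : exists y, y \notin (f @: A)%SET.
  apply/existsP; apply: contraT; rewrite negb_exists => /forallP fA.
  have := max_card (mem (x |: A)%SET); rewrite cardsU1 xA -(card_in_imset fI).
  rewrite (_ : (f @: A)%SET = [set: I]%SET) ?cardsT ?add1n ?ltnn //.
  by apply/setP => y; rewrite inE; have := fA y; rewrite negbK.
pose f' z := if z == x then y else f z.
have f'A z : z \in A -> f' z = f z.
  by move=> zA; rewrite /f'; case: eqP => // E; rewrite -E zA in xA.
have [||g [gbij fg]] := IHk (x |: A)%SET f'.
- move: Ak; rewrite (cardsD1 x) inE xA add1n ltnS; apply: leq_ltn_trans.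
  apply/subset_leq_card/fintype.subsetP => z; rewrite !inE negb_or.
  by case/andP=> -> ->.
- move=> z z'; rewrite !inE => /predU1P[->|zA] /predU1P[->|z'A] //.
  + rewrite (f'A _ z'A) /f' eqxx => E.
    by case/imsetP: yA; exists z'.
  + rewrite (f'A _ zA) /f' eqxx => E.
    by case/imsetP: yA; exists z.
  + by rewrite !f'A //; apply: fI.
- exists g; split=> // z zA; rewrite -fg ?f'A //.
  by rewrite !inE zA orbT.
Qed.

Lemma extend_inj (S : Type) (A : set S) (f : S -> S) : finite_set [set: S] ->
  (forall x y, A x -> A y -> f x = f y -> x = y) ->
  exists g : S -> S, bijective g /\ forall x, A x -> g x = f x.
Proof.
move=> /finite_set_enum[n [k [kI kS]]] fI.
have ex x : exists i, k i = x.
  by have : [set: S] x by []; rewrite -kS => -[i _ <-]; exists i.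
pose r x := sval (cid (ex x)).
have rK : cancel r k by move=> x; rewrite /r; case: cid.
have kK : cancel k r by move=> i; apply: kI; rewrite rK.
have [|g [[g' gK g'K] fg]] :=
    @extend_inj_fin _ [set i | `[< A (k i) >]]%SET (r \o f \o k).
  move=> i j; rewrite inE => /asboolP Ai;
    rewrite inE => /asboolP Aj /(can_inj rK).
  by move=> /(fI _ _ Ai Aj)/kI.
exists (k \o g \o r); split.
  by exists (k \o g' \o r) => x; rewrite /= kK ?gK ?g'K rK.
by move=> x Ax; rewrite /= -fg ?inE /= ?rK.
Qed.

(** Carrying the inverse along makes the data symmetric; what is proved about the
    images of vertices then applies to both maps. *)
Record star_pair (L : simplicialComplex) (s s' : set L)
    (phi psi : set L -> set L) : Prop := StarPair {
  sp_simplex : simplex L s;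
  sp_base : phi s = s';
  sp_star : forall t, open_star s t -> open_star s' (phi t);
  sp_star' : forall t, open_star s' t -> open_star s (psi t);
  sp_K : forall t, open_star s t -> psi (phi t) = t;
  sp_K' : forall t, open_star s' t -> phi (psi t) = t;
  sp_sub : forall t u, open_star s t -> open_star s u ->
    (t `<=` u <-> phi t `<=` phi u) }.

Section StarIso.
Variables (L : simplicialComplex) (s s' : set L) (phi psi : set L -> set L).
Hypothesis flagL : flag L.
Hypothesis D : star_pair s s' phi psi.

Let Ls := sp_simplex D.
Let phi_s := sp_base D.
Let phi_star := sp_star D.
Let psi_star := sp_star' D.
Let phiK := sp_K D.
Let psiK := sp_K' D.
Let phi_sub := sp_sub D.

(** For a outside s these are two consecutive simplices of the open star. *)
Definition below (r : set L) (a : L) : set L := [set p | r p /\ adjacent a p].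

Definition above (r : set L) (a : L) : set L := below r a `|` [set a].

Lemma below_star a p : s p -> adjacent a p -> open_star s (below s a).
Proof.
move=> sp ap; split; last by exists p.
by apply: simplex_sub Ls _ _; [move=> q []|exists p].
Qed.

Lemma above_star a p : s p -> adjacent a p -> open_star s (above s a).
Proof.
move=> sp ap; split; last by exists p; split=> //; left.
apply: flagL; [|by exists a; right|].
  rewrite finite_setU; split=> //.
  by apply: sub_finite_set (simplex_finite Ls) => q [].
move=> x y [[sx ax]|->] [[sy ay]|->] xy //.
  exact: simplex_adjacent Ls _ _ _.
exact: adjacent_sym.
Qed.

(** A vertex a outside s is not a simplex of the open star of s; its image is read
    off from the images of two simplices that differ by a. *)
Definition vertex_image (a a' : L) : Prop :=
  s a /\ phi [set a] = [set a'] \/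
  [/\ ~ s a, phi (above s a) = phi (below s a) `|` [set a']
    & ~ phi (below s a) a'].

(** Nothing lies strictly between the two simplices attached to a, hence between
    their images, which therefore differ by one vertex. *)
Lemma vertex_image_exists a : (exists2 p, s p & adjeq a p) ->
  exists a', vertex_image a a'.
Proof.
move=> [p sp ap]; have [sa|nsa] := pselect (s a).
  have sta := open_star_vertex sa.
  have [x phix] := simplex_nonempty (proj1 (phi_star sta)).
  have s'x : s' x.
    rewrite -phi_s; apply: ((phi_sub sta (open_star_self Ls)).1 _ x phix).
    by move=> _ ->.
  have stx := open_star_vertex s'x.
  exists x; left; split=> //; rewrite -[RHS](psiK stx); congr phi.
  have sub : psi [set x] `<=` [set a].
    apply/(phi_sub (psi_star stx) sta); rewrite (psiK stx).
    by move=> _ ->.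
  apply/seteqP; split=> // _ ->.
  have [y yx] := simplex_nonempty (proj1 (psi_star stx)).
  by rewrite -(sub y yx).
have {}ap : adjacent a p by case: ap => // E; rewrite E in nsa.
have stb := below_star sp ap; have sta := above_star sp ap.
have ba : below s a `<=` above s a by move=> q; left.
have [a' [a'a a'b]] : exists a', phi (above s a) a' /\ ~ phi (below s a) a'.
  apply: contrapT => /forallNP N.
  have /(_ a (or_intror erefl)) : above s a `<=` below s a.
    apply/(phi_sub sta stb) => x xa; apply: contrapT => xb.
    by case: (N x).
  by move=> [_ []].
exists a'; right; split=> //.
set u := phi (below s a) `|` [set a'].
have ua : u `<=` phi (above s a).
  by move=> x [|-> //]; apply: ((phi_sub stb sta).1 ba).
have stu : open_star s' u.
  apply: open_star_sub (phi_star stb) _ _; last by move=> x; left.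
  apply: simplex_sub (proj1 (phi_star sta)) ua _.
  by exists a'; right.
rewrite -[RHS](psiK stu); congr phi.
have ua' : psi u `<=` above s a.
  by apply/(phi_sub (psi_star stu) sta); rewrite psiK.
have bu : below s a `<=` psi u.
  by apply/(phi_sub stb (psi_star stu)); rewrite psiK // => x; left.
apply/seteqP; split=> // x [|->]; first exact: bu.
apply: contrapT => nua; apply: a'b.
apply: ((phi_sub (psi_star stu) stb).1 _ a' _); last by rewrite psiK //; right.
move=> x' ux'; have [//|E] := ua' x' ux'.
by rewrite E in ux'.
Qed.

(** Otherwise the intersection of t with the simplex above a would be mapped into
    the image of the simplex below a, and would not contain a. *)
Lemma vertex_image_mem a a' t : vertex_image a a' -> open_star s t -> t a ->
  phi t a'.
Proof.
move=> + st ta => -[[sa E]|[nsa E N]].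
  have : phi [set a] a' by rewrite E.
  by apply: ((phi_sub (open_star_vertex sa) st).1 _ a') => _ ->.
apply: contrapT => nta'; have [_ [p [tp sp]]] := st.
have ap : adjacent a p.
  by case: (open_star_adjeq st ta tp) => // E'; rewrite E' in nsa.
have stb := below_star sp ap; have sta := above_star sp ap.
have sti : open_star s (t `&` above s a).
  split; last by exists p; split=> //; split=> //; left.
  apply: simplex_sub (proj1 st) _ _; first by move=> x [].
  by exists a; split=> //; right.
have /(_ a) : t `&` above s a `<=` below s a.
  apply/(phi_sub sti stb) => x xi.
  have xt : phi t x by apply: ((phi_sub sti st).1 _ x xi) => y [].
  have : phi (above s a) x by apply: ((phi_sub sti sta).1 _ x xi) => y [].
  by rewrite E => -[//|xa']; rewrite xa' in xt.
by case=> [|_ []//]; split=> //; right.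
Qed.

Lemma star_pair_sym : star_pair s' s psi phi.
Proof.
have ss := open_star_self Ls; split=> //.
- by rewrite -phi_s; apply: proj1 (phi_star ss).
- by rewrite -phi_s phiK.
- move=> t u st su; rewrite -{1}(psiK st) -{1}(psiK su).
  by rewrite (phi_sub (psi_star st) (psi_star su)).
Qed.

End StarIso.

(** The vertex c lies in every simplex of the star containing a.  A simplex
    spanned by a and one vertex p of s leaves only p as an alternative, and p is
    excluded because it belongs to the simplex below a. *)
Lemma vertex_imageK (L : simplicialComplex) (s s' : set L) phi psi a b c :
  flag L -> star_pair s s' phi psi -> (exists2 p, s p & adjeq a p) ->
  vertex_image s phi a b -> vertex_image s' psi b c -> c = a.
Proof.
move=> flagL D [p sp ap] ab bc; have D' := star_pair_sym D.
have psi_c t : open_star s t -> t a -> t c.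
  move=> st ta; rewrite -(sp_K D st).
  apply: (vertex_image_mem flagL D' bc); first exact: sp_star D _ st.
  exact: (vertex_image_mem flagL D ab st ta).
have [sa|nsa] := pselect (s a).
  exact: (psi_c _ (open_star_vertex sa) erefl).
have {}ap : adjacent a p by case: ap => // E; rewrite E in nsa.
pose t := [set a; p].
have st : open_star s t by split; [case: ap|exists p; split=> //; right].
have [//|cp] := psi_c t st (or_introl erefl); rewrite cp in bc *.
have sb := below_star D sp ap.
have bp : below s a p by [].
have tb : phi t b := vertex_image_mem flagL D ab st (or_introl erefl).
case: ab => [[//]|[_ aE nb]]; case: nb.
have stp := open_star_vertex sp; have phi_p := sp_star D stp.
have [x [xp s'x]] := proj2 phi_p.
have sub_b : phi [set p] `<=` phi (below s a).
  by apply/(sp_sub D stp sb) => _ ->.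
have stx := open_star_vertex s'x.
have psi_x : psi [set x] = [set p].
  have sub : psi [set x] `<=` [set p].
    apply/(sp_sub D (sp_star' D stx) stp); rewrite (sp_K' D stx).
    by move=> _ ->.
  apply/seteqP; split=> // _ ->.
  have [y yx] := simplex_nonempty (proj1 (sp_star' D stx)).
  by rewrite -(sub y yx).
case: bc => [[s'b E]|[ns'b _ N]].
  apply: sub_b; have stb := open_star_vertex s'b.
  by rewrite -E (sp_K' D stb).
case: N; have phit := sp_star D st.
have tx : phi t x.
  by apply: ((sp_sub D stp st).1 _ x xp) => _ ->; right.
have bx : adjacent b x.
  by apply: simplex_adjacent (proj1 phit) tb tx _ => E; rewrite E in ns'b.
have sb' := below_star D' s'x bx.
apply: ((sp_sub D' stx sb').1 _ p); last by rewrite psi_x.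
by move=> _ ->.
Qed.

(** The vertex images define an injection on the vertices adjacent or equal to a
    vertex of s, and any extension m of it to a permutation will do: the last two
    properties only involve simplices that meet s. *)
Lemma star_iso_bijection (L : simplicialComplex) (s s' : set L)
    (phi : set L -> set L) :
  sc_finite L -> flag L -> simplex L s -> is_star_iso s s' phi -> phi s = s' ->
  exists m : L -> L, [/\ bijective m,
    forall t, open_star s t -> m @` t = phi t &
    forall t, t `&` s !=set0 -> (simplex L (m @` t) <-> simplex L t)].
Proof.
move=> finL flagL Ls [[phi_star phi_inj phi_surj] _ phi_sub] phi_s.
have ex t' : exists t, open_star s' t' -> open_star s t /\ phi t = t'.
  have [st'|] := pselect (open_star s' t'); last by exists t'.
  by have [t st tE] := phi_surj t' st'; exists t.
pose psi t' := sval (cid (ex t')).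
have psiP t' : open_star s' t' -> open_star s (psi t') /\ phi (psi t') = t'.
  by rewrite /psi; case: cid.
have D : star_pair s s' phi psi.
  split=> //; [by move=> t /psiP[]| |by move=> t /psiP[]].
  move=> t st; have st' : open_star s' (phi t) by apply: phi_star.
  by apply: phi_inj; rewrite ?inE; case: (psiP _ st').
have D' := star_pair_sym D.
have near t a : open_star s t -> t a -> exists2 p, s p & adjeq a p.
  move=> st ta; have [_ [p [tp sp]]] := st.
  by exists p => //; apply: open_star_adjeq st ta tp.
have near' t a : open_star s' t -> t a -> exists2 p, s' p & adjeq a p.
  move=> st ta; have [_ [p [tp sp]]] := st.
  by exists p => //; apply: open_star_adjeq st ta tp.
have near_star a : (exists2 p, s p & adjeq a p) ->
    exists2 t, open_star s t & t a.
  move=> [p sp [E|ap]].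
    by exists [set a] => //; apply: open_star_vertex; rewrite E.
  exists [set a; p]; last by left.
  by split; [case: ap|exists p; split=> //; right].
have im_ex a : exists a', (exists2 p, s p & adjeq a p) ->
    vertex_image s phi a a'.
  have [na|] := pselect (exists2 p, s p & adjeq a p); last by exists a.
  by have [a' a'P] := vertex_image_exists flagL D na; exists a'.
pose m0 a := sval (cid (im_ex a)).
have m0P a : (exists2 p, s p & adjeq a p) -> vertex_image s phi a (m0 a).
  by rewrite /m0; case: cid.
have m0_near a : (exists2 p, s p & adjeq a p) ->
    exists2 p, s' p & adjeq (m0 a) p.
  move=> na; have [t st ta] := near_star a na.
  apply: (near' _ _ (sp_star D st)).
  exact: (vertex_image_mem flagL D (m0P a na) st ta).
have m0I a b : (exists2 p, s p & adjeq a p) -> (exists2 p, s p & adjeq b p) ->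
    m0 a = m0 b -> a = b.
  move=> na nb ab; have [c ac] := vertex_image_exists flagL D' (m0_near a na).
  rewrite -(vertex_imageK flagL D na (m0P a na) ac).
  by apply: (vertex_imageK flagL D nb (m0P b nb)); rewrite -ab.
have [m [mbij mE]] := extend_inj finL m0I.
have mphi t : open_star s t -> m @` t = phi t.
  move=> st; have phit := sp_star D st.
  apply/seteqP; split=> [_ [a ta <-]|y ty].
    have na := near t a st ta; rewrite (mE a na).
    exact: (vertex_image_mem flagL D (m0P a na) st ta).
  have ny := near' _ _ phit ty; have [c yc] := vertex_image_exists flagL D' ny.
  have tc : t c.
    by rewrite -(sp_K D st); apply: (vertex_image_mem flagL D' yc phit ty).
  have nc := near t c st tc; exists c => //; rewrite (mE c nc).
  exact: (vertex_imageK flagL D' ny yc (m0P c nc)).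
exists m; split=> // t [a [ta sa]]; split=> Lt.
  have st' : open_star s' (m @` t).
    split=> //; exists (m a); split; first by exists a.
    have : (m @` [set a]) (m a) by exists a.
    rewrite mphi; last exact: open_star_vertex.
    have sta := open_star_vertex sa; have sts := open_star_self Ls.
    rewrite -phi_s; apply: ((sp_sub D sta sts).1 _ (m a)).
    by move=> _ ->.
  have [st tE] := psiP _ st'; rewrite -(mphi _ st) in tE.
  suff -> : t = psi (m @` t) by case: st.
  have mI := bij_inj mbij; apply/seteqP; split=> x xt.
    have : (m @` psi (m @` t)) (m x) by rewrite tE; exists x.
    by move=> [y yt /mI <-].
  have : (m @` t) (m x) by rewrite -tE; exists x.
  by move=> [y yt /mI <-].
by rewrite mphi; [apply: (proj1 (sp_star D _))|]; split=> //; exists a.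
Qed.

(** * Isomorphisms between unfoldings *)

Section UnfoldingTransport.
Variables (T : choiceType) (A : (T -> bool) -> T -> T -> Prop).
Hypothesis A_irr : forall x a, ~ A x a a.
Hypothesis A_sym : forall x a b, A x a b -> A x b a.
Hypothesis A_flip : forall x a b, A x a b -> A (pflip x a) a b.
Hypothesis A_flip3 : forall x a b c, A x a b -> A x a c -> A x b c ->
  A (pflip x a) b c.

Local Notation U := (unfolding A_irr).
Local Notation uedge := (uedge A_irr A_sym A_flip A_flip3).

Lemma square_exists u a b : A (vpar u) a b -> exists c : U 2,
  [/\ edge_at c (cube0 2) ord0 = uedge u a,
      edge_at c (cube0 2) ord_max = uedge u b &
      edge_at c cube10 ord_max = uedge (nb u a) b].
Proof.
move=> ab; have [|c [cu cl]] := ucell_exists A_sym A_flip A_flip3 (n := 2)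
    (u := u) (h := fun i => if i == ord0 then a else b).
  by move=> [[|[|//]] ?] [[|[|//]] ?] //= _; exact: A_sym.
exists c; rewrite !(edge_at_uedge A_sym A_flip A_flip3) -flip_cube0_2.
by rewrite ucornerP cu cl.
Qed.

Lemma spans_uedge u a b : spans (uedge u a) (uedge u b) <-> A (vpar u) a b.
Proof.
split=> [[c ca cb]|/square_exists[c [ca cb _]]]; last by exists c.
have := ucliqueP c (cube0 2) (i := ord0) (j := ord_max) isT.
rewrite -!(label_of_edge_at c (cube0 2)) ca cb !label_of_uedge.
rewrite -(vertex_of_corner (A_irr := A_irr)) -(source_edge_at _ _ ord0) ca.
by rewrite source_uedge vertex_of_uvertex.
Qed.

Lemma transport_uedge u a b : a = b \/ A (vpar u) a b ->
  transport (uedge u a) (uedge u b) (uedge (nb u a) b).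
Proof.
move=> [<-|/square_exists[c ?]]; last by right; exists c.
by left; rewrite reverse_uedge.
Qed.

Lemma transport_label (e e1 e2 : U 1) :
  transport e e1 e2 -> label_of e2 = label_of e1.
Proof.
by move=> [[-> ->]|[c [_ <- <-]]]; rewrite !label_of_edge_at.
Qed.

End UnfoldingTransport.

Lemma mor_spans (X Y : cubeComplex) (F : forall n, X n -> Y n) :
  (forall m n (f : cubeMap m n) c, F m (res f c) = res f (F n c)) ->
  forall e e', spans e e' -> spans (F 1 e) (F 1 e').
Proof.
by move=> Fres e e' [c <- <-]; exists (F 2 c); rewrite -(mor_edge_at Fres).
Qed.

Lemma mor_transport (X Y : cubeComplex) (F : forall n, X n -> Y n) :
  (forall m n (f : cubeMap m n) c, F m (res f c) = res f (F n c)) ->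
  forall e e1 e2, transport e e1 e2 -> transport (F 1 e) (F 1 e1) (F 1 e2).
Proof.
move=> Fres e e1 e2 [[-> ->]|[c [<- <- <-]]].
  by left; rewrite (mor_reverse Fres).
by right; exists (F 2 c); rewrite -!(mor_edge_at Fres).
Qed.

(** An isomorphism of unfoldings is described by its action on the labels at
    each vertex: these actions identify the links, and neighbouring vertices
    act alike on the labels that can be transported between them. *)
Lemma iso_labels (T : choiceType) (A B : (T -> bool) -> T -> T -> Prop)
  (A_irr : forall x a, ~ A x a a) (B_irr : forall x a, ~ B x a a)
  (A_sym : forall x a b, A x a b -> A x b a)
  (B_sym : forall x a b, B x a b -> B x b a)
  (A_flip : forall x a b, A x a b -> A (pflip x a) a b)
  (B_flip : forall x a b, B x a b -> B (pflip x a) a b)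
  (A_flip3 : forall x a b c, A x a b -> A x a c -> A x b c -> A (pflip x a) b c)
  (B_flip3 : forall x a b c, B x a b -> B x a c -> B x b c ->
    B (pflip x a) b c) :
  cc_isomorphic (unfolding A_irr) (unfolding B_irr) ->
  exists (p : vert A -> vert B) (q : vert A -> T -> T), forall u,
  [/\ bijective (q u),
      forall a b, B (vpar (p u)) (q u a) (q u b) <-> A (vpar u) a b &
      forall a b, a = b \/ A (vpar u) a b -> q (nb u a) b = q u b].
Proof.
move=> /cc_isoP[F [G [FK GK Fres Gres]]].
pose p u := vertex_of (F 0 (uvertex A_irr A_sym A_flip A_flip3 u)).
pose q u a := label_of (F 1 (uedge A_irr A_sym A_flip A_flip3 u a)).
have FE u a : F 1 (uedge A_irr A_sym A_flip A_flip3 u a) =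
    uedge B_irr B_sym B_flip B_flip3 (p u) (q u a).
  by rewrite [LHS](uedgeE B_sym B_flip B_flip3) -(mor_source Fres) source_uedge.
have GE u b (e := G 1 (uedge B_irr B_sym B_flip B_flip3 (p u) b)) :
    e = uedge A_irr A_sym A_flip A_flip3 u (label_of e).
  rewrite [LHS](uedgeE A_sym A_flip A_flip3) -(mor_source Gres) source_uedge.
  by rewrite uvertex_vertex_of FK vertex_of_uvertex.
exists p, q => u; split.
- exists (fun b => label_of (G 1 (uedge B_irr B_sym B_flip B_flip3 (p u) b)))
  => [a|b].
    by rewrite -FE FK label_of_uedge.
  by rewrite /q -GE GK label_of_uedge.
- move=> a b; rewrite -(spans_uedge B_irr B_sym B_flip B_flip3).
  rewrite -(spans_uedge A_irr A_sym A_flip A_flip3).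
  rewrite -!FE.
  split; last exact: mor_spans Fres _ _.
  by move=> /(mor_spans Gres); rewrite !FK.
- move=> a b ab; apply: transport_label; apply: (mor_transport Fres).
  exact: transport_uedge.
Qed.

(** * Filling cubes of automorphisms *)

Section CubicalFilling.
Variables (L : simplicialComplex) (n : nat) (h : 'I_n -> L).
Hypothesis h_adj : forall i j, adjeq (h i) (h j).

Definition adj_aut (f : L -> L) :=
  bijective f /\ forall a b, adjacent (f a) (f b) <-> adjacent a b.

Lemma adj_aut_adjeq f a b : adj_aut f -> adjeq (f a) (f b) <-> adjeq a b.
Proof.
move=> [fbij fadj]; split=> -[E|/fadj]; try by right.
  by left; apply: bij_inj fbij _ _ E.
by left; rewrite E.
Qed.

Lemma adj_aut_comp f g : adj_aut f -> adj_aut g -> adj_aut (f \o g).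
Proof.
move=> [fb fa] [gb ga]; split; first exact: bij_comp.
by move=> a b /=; rewrite fa ga.
Qed.

Lemma inv_exists (f : L -> L) :
  exists g, bijective f -> cancel f g /\ cancel g f.
Proof.
have [[g fK gK]|] := pselect (bijective f); last by exists id.
by exists g.
Qed.

Definition inv (f : L -> L) : L -> L := sval (cid (inv_exists f)).

Lemma invK f : bijective f -> cancel f (inv f) /\ cancel (inv f) f.
Proof. by rewrite /inv; case: cid. Qed.

Lemma adj_aut_inv f : adj_aut f -> adj_aut (inv f).
Proof.
move=> [fb fa]; have [fK Kf] := invK fb; split; first by exists f.
by move=> a b; rewrite -{2}(Kf a) -{2}(Kf b) fa.
Qed.

Variable g : cube n -> L -> L.
Hypothesis g_aut : forall v, v != cube0 n -> adj_aut (g v).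
Hypothesis g_flip : forall v i b, adjeq (h i) b -> g (flip v i) b = g v b.

Lemma g_label v i : g v (h i) = g (cube0 n) (h i).
Proof. by elim/cube_ind: v => // v j <-; apply: g_flip. Qed.

Definition filling (Ga : cube n -> L -> L) :=
  [/\ forall v, adj_aut (Ga v),
      forall v i, Ga v (h i) = g (cube0 n) (h i) &
      forall v i b, adjeq (h i) b -> Ga (flip v i) b = Ga v b].

Definition raise (v : cube n) (j : 'I_n) : cube n :=
  [ffun k => (k == j) || v k].

Lemma raise_neq0 v j : raise v j != cube0 n.
Proof. by apply/eqP => /ffunP/(_ j); rewrite !ffunE eqxx. Qed.

(** The family g is an open box in the cubical group of families of automorphisms.
    As for simplicial groups, a filler is built by correcting an arbitrary full
    cube, here a constant one, along one face after the other: on the face j the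
    new family agrees with g, and where the old family already agreed with g
    nothing changes. *)
Lemma filling_exists (r : seq 'I_n) : n > 0 -> exists2 Ga, filling Ga &
  forall (v : cube n) i, i \in r -> v i -> Ga v =1 g v.
Proof.
move=> n0; elim: r => [|j r [Ga [Ga_aut Ga_label Ga_flip] Ga_g]].
  exists (fun=> g (cube1 n)) => //; split=> // [_|v i]; last exact: g_label.
  by apply: g_aut; apply/eqP => /ffunP/(_ (Ordinal n0)); rewrite !ffunE.
pose back v := inv (Ga (raise v j)) \o g (raise v j).
have raise_aut v : adj_aut (g (raise v j)) by apply/g_aut/raise_neq0.
have back_aut v : adj_aut (back v).
  by apply: adj_aut_comp => //; apply: adj_aut_inv.
have GaK v : cancel (Ga v) (inv (Ga v)) /\ cancel (inv (Ga v)) (Ga v).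
  exact/invK/(proj1 (Ga_aut v)).
have back_label v i : back v (h i) = h i.
  by rewrite /back /= g_label -(Ga_label (raise v j)) (proj1 (GaK _)).
have back_adjeq v i b : adjeq (h i) b -> adjeq (h i) (back v b).
  by move=> ib; rewrite -(back_label v i); apply/adj_aut_adjeq.
have raise_id (v : cube n) : v j -> raise v j = v.
  by move=> vj; apply/ffunP => k; rewrite ffunE; case: eqP => // ->.
have back_flip v i b : adjeq (h i) b -> back (flip v i) b = back v b.
  move=> ib; have [->|ij] := eqVneq i j.
    rewrite /back (_ : raise (flip v j) j = raise v j) //.
    by apply/ffunP => k; rewrite !ffunE; case: eqP => //= _; rewrite addbF.
  have E : raise (flip v i) j = flip (raise v j) i.
    apply/ffunP => k; rewrite !ffunE; have [->|kj] //= := eqVneq k j.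
    by rewrite eq_sym (negbTE ij).
  apply: (can_inj (proj1 (GaK (raise (flip v i) j)))).
  rewrite /back /= (proj2 (GaK _)) E g_flip // Ga_flip; last exact: back_adjeq.
  by rewrite (proj2 (GaK _)).
exists (fun v => Ga v \o back v); first split.
- by move=> v; apply: adj_aut_comp.
- by move=> v i; rewrite /= back_label.
- by move=> v i b ib /=; rewrite back_flip // Ga_flip //; apply: back_adjeq.
move=> v i; rewrite inE => /predU1P[->|ir] vi b /=.
  by rewrite /back /= raise_id // (proj2 (GaK _)).
have rvi : raise v j i by rewrite ffunE vi orbT.
rewrite /back /= -(Ga_g (raise v j) i ir rvi) (proj1 (GaK _)).
exact: Ga_g ir vi b.
Qed.

Lemma open_box_corner : n > 0 -> exists2 Psi, adj_aut Psi &
  forall i b, adjeq (h i) b -> Psi b = g (cube0 n) b.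
Proof.
move=> n0; have [Ga [Ga_aut _ Ga_flip] Ga_g] := filling_exists (enum 'I_n) n0.
exists (Ga (cube0 n)) => // i b ib;
  rewrite -(Ga_flip _ _ _ ib) -(g_flip (cube0 n) ib).
by apply: (Ga_g _ i); rewrite ?mem_enum // !ffunE eqxx.
Qed.

End CubicalFilling.

(** * Twisted unfoldings *)

Section Twist.
Variables (L : simplicialComplex) (s : set L) (m : L -> L).
Hypothesis flagL : flag L.
Hypothesis Ls : simplex L s.
Hypothesis m_bij : bijective m.
Hypothesis m_star : forall t, t `&` s !=set0 ->
  (simplex L (m @` t) <-> simplex L t).

Local Notation T := {classic L}.

Let m_inj := bij_inj m_bij.

Lemma twist_adj a b : s a -> adjacent (m a) (m b) <-> adjacent a b.
Proof.
move=> sa; have E : simplex L [set m a; m b] <-> simplex L [set a; b].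
  by rewrite -image_set2; apply: m_star; exists a; split=> //; left.
split=> -[ab /E Lab]; split=> //; last by move=> /m_inj.
by move=> E'; apply: ab; rewrite E'.
Qed.

Lemma simplex3 (K : simplicialComplex) (a b c : K) : flag K ->
  adjacent a b -> adjacent a c -> adjacent b c ->
  simplex K ([set a; b] `|` [set c]).
Proof.
move=> flagK ab ac bc; apply: flagK.
- by rewrite !finite_setU.
- by exists c; right.
- by move=> x y [[->|->]|->] [[->|->]|->] xy //; apply: adjacent_sym.
Qed.

Lemma twist_adj2 a b c : s a -> adjacent a b -> adjacent a c ->
  adjacent (m b) (m c) <-> adjacent b c.
Proof.
move=> sa ab ac.
have E : simplex L ([set m a; m b] `|` [set m c]) <->
    simplex L ([set a; b] `|` [set c]).
  rewrite -image_set2 -image_set1 -image_setU; apply: m_star.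
  by exists a; split=> //; left; left.
have mab := (twist_adj b sa).2 ab; have mac := (twist_adj c sa).2 ac.
split=> bc.
  have /E Labc := simplex3 flagL mab mac bc.
  apply: simplex_adjacent Labc _ _ _; [by left; right|by right|].
  by move=> bc'; case: bc => -[]; rewrite bc'.
have /E Labc := simplex3 flagL ab ac bc.
apply: simplex_adjacent Labc _ _ _; [by left; right|by right|].
by move=> /m_inj; case: bc.
Qed.

(** The vertices whose parities vanish on s form a sector of the cube of all
    parities.  Inside it the link is L with its vertices renamed by m; this is
    coherent with the untwisted links outside, because an edge leaving the
    sector is labelled by a vertex p of s, and a set of vertices containing p is a
    simplex if and only if its image under m is one. *)
Definition in_sector (x : T -> bool) : Prop := forall p : L, s p -> x p = false.

Definition twist (x : T -> bool) : L -> L :=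
  if `[< in_sector x >] then m else id.

Definition twist_rel (x : T -> bool) (a b : T) : Prop :=
  adjacent (twist x a) (twist x b).

Lemma twist_flip x (a : T) : s a \/ twist (pflip x a) = twist x.
Proof.
have [sa|nsa] := pselect (s a); [by left|right].
rewrite /twist; congr (if _ then _ else _); apply: asbool_equiv_eq.
have E (p : T) : s p -> pflip x a p = x p.
  move=> sp; rewrite /pflip; case: eqP => // ap.
  by case: nsa; rewrite ap.
by split=> sx p sp; have := sx p sp; rewrite E.
Qed.

Lemma twist_relE x a b : s a -> twist_rel x a b <-> adjacent a b.
Proof.
by move=> sa; rewrite /twist_rel /twist; case: ifP => // _; apply: twist_adj.
Qed.

Lemma twist_relE2 x a b c : s a -> adjacent a b -> adjacent a c ->
  twist_rel x b c <-> adjacent b c.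
Proof.
move=> sa ab ac; rewrite /twist_rel /twist; case: ifP => // _.
exact: twist_adj2 sa ab ac.
Qed.

Lemma twist_irr x a : ~ twist_rel x a a.
Proof. by case. Qed.

Lemma twist_sym x a b : twist_rel x a b -> twist_rel x b a.
Proof. exact: adjacent_sym. Qed.

Lemma twist_rel_flip x a b : twist_rel x a b -> twist_rel (pflip x a) a b.
Proof.
have [sa|E] := twist_flip x a; last by rewrite /twist_rel E.
by move=> /(twist_relE _ _ sa) ab; apply/twist_relE.
Qed.

Lemma twist_rel_flip3 x a b c : twist_rel x a b -> twist_rel x a c ->
  twist_rel x b c -> twist_rel (pflip x a) b c.
Proof.
have [sa|E] := twist_flip x a; last by rewrite /twist_rel E.
move=> /(twist_relE _ _ sa) ab /(twist_relE _ _ sa) ac.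
by move=> /(twist_relE2 _ sa ab ac) bc; apply/(twist_relE2 _ sa ab ac).
Qed.

Definition twisted : cubeComplex := unfolding twist_irr.

Lemma twist_bij x : bijective (twist x).
Proof. by rewrite /twist; case: ifP => // _; exists id. Qed.

Lemma twisted_CAT0 : CAT0 twisted.
Proof.
exact: (unfolding_CAT0 twist_irr twist_sym twist_rel_flip twist_rel_flip3
  flagL twist_bij (fun _ _ _ => iff_refl _)).
Qed.

Lemma twisted_over : cube_complex_over L twisted.
Proof.
exact: (unfolding_over (A_irr := twist_irr) twist_sym twist_rel_flip
  twist_rel_flip3  flagL twist_bij (fun _ _ _ => iff_refl _)).
Qed.

(** Around the cube spanned by s at the base vertex, an isomorphism with the
    Davis complex provides an automorphism of L at every corner but the base
    vertex, where it provides an isomorphism from the renamed L to L.  Filling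
    this open box and composing with the renaming extends m. *)
Lemma twisted_extension : cc_isomorphic twisted (davis_unfolding L) ->
  exists2 Phi : L -> L, is_sc_iso Phi &
    forall a b, s a -> adjeq a b -> Phi b = m b.
Proof.
move=> iso.
have [p [q pq]] := iso_labels (A := twist_rel) (B := fun=> @gen_adj L)
  twist_sym (fun=> @gen_adj_sym L) twist_rel_flip (fun _ _ _ h => h)
  twist_rel_flip3 (fun _ _ _ _ _ _ h => h) iso.
have [n [h [hI hs]]] := finite_set_enum (simplex_finite Ls).
have sh i : s (h i) by rewrite -hs; exists i.
have h_adj i j : adjeq (h i) (h j).
  have [->|ij] := eqVneq i j; first by left.
  by right; apply: simplex_adjacent Ls _ _ _ => // /hI; apply/eqP.
pose o := vclass twist_rel [::].
have [|c [co ch]] := ucell_exists twist_sym twist_rel_flip twist_rel_flip3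
    (n := n) (u := o) (h := h).
  move=> i j ij; apply/twist_relE => //.
  by case: (h_adj i j) => // /hI E; rewrite E eqxx in ij.
pose g v : L -> L := q (ucorner c v).
have vparE v i : vpar (ucorner c v) (h i) = v i.
  by rewrite -ch (ucorner_vpar twist_irr) co vpar_vclass addbF.
have sector v : in_sector (vpar (ucorner c v)) -> v = cube0 n.
  by move=> sx; apply/ffunP => i; rewrite ffunE -vparE; apply: sx.
have g_aut v : v != cube0 n -> adj_aut (g v).
  move=> /eqP v0; have [qbij qadj _] := pq (ucorner c v); split=> // a b.
  by rewrite [adjacent _ _](qadj a b) /twist_rel /twist asboolF // => /sector.
have g_flip v i b : adjeq (h i) b -> g (flip v i) b = g v b.
  move=> ib; have [_ _ qnb] := pq (ucorner c v).
  rewrite /g ucornerP ch; apply: qnb; case: ib => [->|ib]; first by left.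
  by right; apply/twist_relE.
have n0 : n > 0.
  have [a] := simplex_nonempty Ls; rewrite -hs => -[i _ _].
  exact: leq_ltn_trans (leq0n i) (ltn_ord i).
have [Psi [Psi_bij Psi_adj] PsiE] := open_box_corner h_adj g_aut g_flip n0.
have [[q' qK Kq] qadj _] := pq o.
have g0 : g (cube0 n) = q o by rewrite /g co.
have sector_o : twist (vpar o) = m.
  by rewrite /twist asboolT // => a sa; rewrite vpar_vclass.
exists (m \o q' \o Psi); last first.
  move=> a b; rewrite -hs => -[i _ <-] ib.
  by rewrite /= (PsiE i) // g0 qK.
apply: flag_sc_iso => // [|a b /=].
  by apply: bij_comp => //; apply: bij_comp => //; exists (q o).
have := qadj (q' (Psi a)) (q' (Psi b)); rewrite !Kq /twist_rel sector_o => <-.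
exact: Psi_adj.
Qed.

End Twist.

(** * Uniqueness and superstar-transitivity *)

Theorem theorem1p2 (L : simplicialComplex) (finL : sc_finite L)
    (flagL : flag L) :
  unique_CAT0_over L (davis L) <-> superstar_transitive L.
Proof.
have iso := davis_unfolding_iso L; have iso' := cc_isomorphic_sym iso.
split=> [[_ _ uniq] s s' phi Ls Ls' phi_iso phi_s|sst].
  have [m [m_bij mE m_star]] := star_iso_bijection finL flagL Ls phi_iso phi_s.
  have X_CAT0 := twisted_CAT0 flagL m_bij m_star.
  have X_over := twisted_over flagL m_bij m_star.
  have [Phi Phi_iso PhiE] := twisted_extension flagL Ls m_bij m_star
    (cc_isomorphic_trans (uniq _ X_CAT0 X_over) iso').
  exists Phi => // t st; rewrite -mE //; have [_ [a [ta sa]]] := st.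
  apply: eq_imagel => b tb; apply: (PhiE a) => //.
  exact: open_star_adjeq st ta tb.
split; first exact: cc_isomorphic_CAT0 iso (davis_unfolding_CAT0 flagL).
  exact: cc_isomorphic_over iso (davis_unfolding_over flagL).
move=> X X_CAT0 X_over.
have [f [th [thP th_co]]] := atlas_exists finL flagL sst X_CAT0 X_over.
apply: cc_isomorphic_trans iso.
exact/cc_isomorphic_sym/(develop_iso X_CAT0 thP th_co).
Qed.
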